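(* Let $\lambda>0$ and $\alpha<\lambda+1$, and let $f\in\mathcal T_{\lambda,\alpha}$. Then the function $x\mapsto (f(x)-f(0))/x^{\lambda}$ on $(0,\infty)$ belongs to $\mathcal S_{\lambda+1-\alpha}$.
   Context: A function $g:(0,\infty)\to\mathbb R$ is completely monotonic if it is infinitely often differentiable and $(-1)^n g^{(n)}(x)\ge 0$ for all $n=0,1,2,\ldots$ and all $x>0$. A function $\varphi:(0,\infty)\to\mathbb R$ is completely monotonic of order $\alpha\in\mathbb R$ if $t\mapsto t^{\alpha}\varphi(t)$ is completely monotonic. For $\lambda>0$ the incomplete Gamma function is $\gamma(\lambda,x)=\int_0^x t^{\lambda-1}e^{-t}\,dt$. For $\lambda>0$ and $\alpha<\lambda+1$, the class $\mathcal T_{\lambda,\alpha}$ of higher order Thorin-Bernstein functions consists of all functions $f$ on $(0,\infty)$ that can be written as $$f(x)=A x^{\lambda}+B+\int_0^\infty \gamma(\lambda,xt)\varphi(t)\,dt,\quad x>0,$$ where $A,B\ge 0$ and $\varphi$ is completely monotonic of order $\alpha$ such that the integral converges for all $x>0$. For such $f$, $f(0)$ denotes $\lim_{x\to0^+}f(x)$ (which exists). For $\lambda>0$, a function $g:(0,\infty)\to\mathbb R$ belongs to the class $\mathcal S_\lambda$ of generalized Stieltjes functions of order $\lambda$ if $$g(x)=\int_0^\infty\frac{d\mu(t)}{(x+t)^\lambda}+c,\quad x>0,$$ for some positive measure $\mu$ on $[0,\infty)$ (making the integral converge for all $x>0$) and some $c\ge 0$. *)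

(* Defs.v *)
From mathcomp Require Import all_boot all_order all_algebra.
From mathcomp Require Import all_classical all_reals all_analysis.

Set Implicit Arguments.
Unset Strict Implicit.
Unset Printing Implicit Defensive.

Import Order.TTheory GRing.Theory Num.Theory.
Import numFieldNormedType.Exports.

Local Open Scope classical_set_scope.
Local Open Scope ring_scope.

(* A function on (0, +oo) is represented by a total function R -> R of which
   only the values at positive arguments are ever used; derivatives and
   right-hand limits below depend on those values only. *)

Definition completely_monotonic (R : realType) (g : R -> R) : Prop :=
  forall (n : nat) (x : R), 0 < x ->
    derivable (derive1n n g) x 1 /\ 0 <= (-1) ^+ n * derive1n n g x.

Definition completely_monotonic_of_order (R : realType) (alpha : R)
    (phi : R -> R) : Prop :=
  completely_monotonic (fun t => t `^ alpha * phi t).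

Definition incomplete_gamma (R : realType) (lambda x : R) : R :=
  \int[lebesgue_measure]_(t in `]0, x[) (t `^ (lambda - 1) * expR (- t)).

Definition thorin_bernstein (R : realType) (lambda alpha : R) : set (R -> R) :=
  [set f | exists (A B : R) (phi : R -> R),
    [/\ 0 <= A, 0 <= B, completely_monotonic_of_order alpha phi,
        (forall x : R, 0 < x ->
           lebesgue_measure.-integrable `]0, +oo[
             (fun t => (incomplete_gamma lambda (x * t) * phi t)%:E)) &
        (forall x : R, 0 < x ->
           f x = A * x `^ lambda + B +
             \int[lebesgue_measure]_(t in `]0, +oo[)
               (incomplete_gamma lambda (x * t) * phi t))]].

(* A positive measure on [0, +oo) is given by a Borel measure on R; its part
   on the negative half-line plays no role. *)
Definition generalized_stieltjes (R : realType) (lambda : R) : set (R -> R) :=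
  [set g | exists (mu : {measure set (measurableTypeR R) -> \bar R}) (c : R),
    [/\ 0 <= c,
        (forall x : R, 0 < x ->
           mu.-integrable `[0, +oo[ (fun t => (((x + t) `^ lambda)^-1)%:E)) &
        (forall x : R, 0 < x ->
           g x = \int[mu]_(t in `[0, +oo[) ((x + t) `^ lambda)^-1 + c)]].

Definition value_at_0 (R : realType) (f : R -> R) : R := lim (f x @[x --> 0^'+]).

(* Main.v *)
Require Import Defs.
From HB Require Import structures.
From mathcomp Require Import all_boot all_order all_algebra.
From mathcomp Require Import all_classical all_reals all_analysis.
From mathcomp Require Import measurable_realfun ring lra.
Import Order.TTheory GRing.Theory Num.Theory.
Import numFieldNormedType.Exports.
Local Open Scope classical_set_scope.
Local Open Scope ring_scope.

Set Implicit Arguments.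
Unset Strict Implicit.
Unset Printing Implicit Defensive.

(** Write psi t = t ^ alpha * phi t, which is completely monotonic, and
    a = lambda + 1 - alpha > 0.  The scaling u = x s in the incomplete Gamma
    function gives
      gamma(lambda, x t) = x ^ lambda * int_0^t s ^ (lambda - 1) e^(- x s) ds,
    so by Tonelli the integral part of f is x ^ lambda times
      int_0^oo s ^ (lambda - 1) e^(- x s) (int_s^oo phi) ds.
    The scaling t = s v turns the tail int_s^oo phi into s ^ (1 - alpha) * h s,
    where h s = int_1^oo v ^ (- alpha) psi (s v) dv is a mixture of dilations
    of psi.  If h is the Laplace transform of a measure nu, a second use of
    Tonelli together with
      int_0^oo s ^ (a - 1) e^(- (x + y) s) ds = Gamma(a) / (x + y) ^ a
    exhibits the integral as x ^ lambda * int Gamma(a) / (x + y) ^ a dnu(y)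
    (thorin_integral_stieltjes).  Moreover f(0) = B, because the integral tends
    to 0 at 0 by dominated convergence (thorin_integral_cvg0).  Hence
    (f x - f(0)) / x ^ lambda is A plus a Stieltjes transform of order a, with
    measure Gamma(a) nu.

    The substance is that h is a Laplace transform, that is, Bernstein's
    theorem.  It is proved here (bernstein_difference) for right-continuous
    functions whose iterated differences g x - g (x + d) are all nonnegative.
    This form of complete monotonicity passes from psi to h by linearity of
    the integral alone, without differentiating under the integral sign
    (tail_mean_difference_monotonic).

    For the theorem itself, fix a base point x and a step d.  The identity
    operator is the sum of the difference and the shift by d; expanding its
    N-th power writes the values g (x + k d) as the normalised factorial moments
    of nonnegative weights w_j carried by the integers j <= N.  For N large
    these are close to the power moments sum_j w_j (j / N) ^ k
    (bernstein_power_moment), that is, after j / N = e^(- d y), to a Laplace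
    transform at k d.  Letting d and x tend to 0, finite atomic measures are
    obtained whose Laplace transforms converge to g (bernstein_atoms_cvg).
    Their distribution functions are locally bounded, hence converge at every
    point along an ultrafilter; the right-continuous regularisation of the limit
    defines a Lebesgue-Stieltjes measure.  Finally e^(- t y) is squeezed between
    decreasing step functions on a grid of mesh d, whose integrals are finite
    combinations of values of the distribution function, so that the
    inequalities survive the limit; the shift by one grid step caused by the
    regularisation costs a factor e^(t d), which tends to 1
    (laplace_atoms_limit). *)

(** * Iterated differences and Bernstein weights *)

Section Differences.
Variable R : realType.
Implicit Types (g : R -> R) (d x : R).

(** The sign is chosen so that a nonincreasing function has a nonnegative
    difference. *)
Definition bdiff d g x := g x - g (x + d).

Definition difference_monotonic g := forall n d x, 0 < d -> 0 < x ->
  0 <= iter n (bdiff d) g x.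

(** The M-th power of the identity, seen as the sum of the difference operator
    and of the shift by d. *)
Lemma difference_newton d g M x :
  g x = \sum_(i < M.+1) 'C(M, i)%:R * iter (M - i) (bdiff d) g (x + i%:R * d).
Proof.
elim: M g x => [|M IH] g x.
  by rewrite big_ord_recr big_ord0 /= add0r bin0 mul1r mul0r addr0.
have -> : g x = bdiff d g x + g (x + d) by rewrite /bdiff subrK.
rewrite (IH (bdiff d g)) (IH g (x + d)).
rewrite [RHS]big_ord_recl [in RHS]/= bin0 mul1r mul0r addr0.
rewrite [in RHS](eq_bigr (fun i : 'I_M.+1 =>
    'C(M, i.+1)%:R * iter (M - i) (bdiff d) g (x + i.+1%:R * d) +
    'C(M, i)%:R * iter (M - i) (bdiff d) g (x + i.+1%:R * d))); last first.
  by move=> i _; rewrite /bump /= add1n binS natrD mulrDl subSS.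
rewrite big_split /= addrA; congr (_ + _).
  rewrite big_ord_recl [in RHS]big_ord_recr /= bin0 mul1r mul0r addr0.
  rewrite (@bin_small M M.+1)// mul0r addr0 -iterSr subn0; congr (_ + _).
  apply: eq_bigr => i _; rewrite /bump /= add1n -iterSr.
  by rewrite -subSn// subSS.
apply: eq_bigr => i _; rewrite (_ : x + d + i%:R * d = x + i.+1%:R * d)//.
by rewrite -natr1; ring.
Qed.

(** With weights w_j, this is a factorial moment of the positions j. It
    reduces to difference_newton by j * C(N, j) = N * C(N - 1, j - 1), which
    lowers k and N by one and moves the base point x by one step. *)
Lemma bernstein_factorial_moment d g N k x : (k <= N)%N ->
  \sum_(j < N.+1) ('C(N, j)%:R * iter (N - j) (bdiff d) g (x + j%:R * d))
     * (j ^_ k)%:R = (N ^_ k)%:R * g (x + k%:R * d).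
Proof.
elim: k N x => [|k IH] N x kN.
  rewrite ffactn0 mul1r mul0r addr0 (difference_newton d g N x).
  by apply: eq_bigr => j _; rewrite ffactn0 mulr1.
case: N kN => [//|N] kN.
rewrite big_ord_recl /= ffact0n mulr0 add0r ffactnS /=.
rewrite natrM -mulrA.
have -> : x + k.+1%:R * d = (x + d) + k%:R * d by rewrite -natr1; ring.
rewrite -IH// mulr_sumr; apply: eq_bigr => i _.
rewrite /bump /= add1n subSS ffactnS /= natrM.
rewrite !mulrA (_ : x + d + i%:R * d = x + i.+1%:R * d); last first.
  by rewrite -natr1; ring.
congr (_ * _); rewrite mulrAC -[in RHS]natrM; congr (_ * _).
by rewrite mul_bin_diag natrM mulrC.
Qed.

(** Both terms are products of k factors in [0, 1], and the i-th factors, j /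
    N and (j - i) / (N - i), differ by at most i / N. *)
Lemma ffact_ratio_bound (N k j : nat) : (k <= N)%N -> (j <= N)%N ->
  (0 < N)%N ->
  0 <= (j%:R / N%:R : R) ^+ k - (j ^_ k)%:R / (N ^_ k)%:R <=
    k%:R ^+ 2 / N%:R.
Proof.
move=> + jN N0; have N0R : 0 < N%:R :> R by rewrite ltr0n.
have p0 : 0 <= j%:R / N%:R :> R by rewrite divr_ge0.
have p1 : j%:R / N%:R <= 1 :> R by rewrite ler_pdivrMr// mul1r ler_nat.
elim: k => [|k IH] kN.
  by rewrite !ffactn0 expr0 divr1 subrr lexx expr0n mul0r lexx.
have /andP[IH0 IH1] := IH (ltnW kN).
have nk0 : (0 : R) < (N - k)%:R by rewrite ltr0n subn_gt0.
rewrite !ffactnSr !natrM exprSr.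
set p := _ / _ in p0 p1 IH0 IH1 *.
set q := (j ^_ k)%:R / _ in IH0 IH1.
have -> : (j ^_ k)%:R * (j - k)%:R / ((N ^_ k)%:R * (N - k)%:R) =
  q * ((j - k)%:R / (N - k)%:R) :> R.
  by rewrite /q invfM; ring.
set a := (j - k)%:R / _.
have q0 : 0 <= q by rewrite divr_ge0.
have q1 : q <= 1 by apply: (@le_trans _ _ (p ^+ k)); [lra|exact: exprn_ile1].
have a0 : 0 <= a by rewrite divr_ge0.
have [ap pa] : a <= p /\ p - a <= k%:R / N%:R.
  rewrite /a /p; have [kj|jk] := leqP k j; last first.
    rewrite (eqP (ltnW jk)) mul0r subr0; split=> //.
    by rewrite ler_pM2r ?invr_gt0// ler_nat ltnW.
  have kN' : k%:R < N%:R :> R by rewrite ltr_nat.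
  have jN' : j%:R <= N%:R :> R by rewrite ler_nat.
  have kj' : k%:R <= j%:R :> R by rewrite ler_nat.
  have k0 : 0 <= k%:R :> R by [].
  rewrite natrB// natrB 1?ltnW//.
  have -> : j%:R / N%:R = j%:R * (N%:R - k%:R) / (N%:R * (N%:R - k%:R)) :> R.
    by field; apply/andP; split; lra.
  have -> : (j%:R - k%:R) / (N%:R - k%:R) =
    (j%:R - k%:R) * N%:R / (N%:R * (N%:R - k%:R)) :> R.
    by field; apply/andP; split; lra.
  have -> : k%:R / N%:R = k%:R * (N%:R - k%:R) / (N%:R * (N%:R - k%:R)) :> R.
    by field; apply/andP; split; lra.
  have NN0 : 0 < (N%:R * (N%:R - k%:R))^-1 :> R.
    by rewrite invr_gt0 mulr_gt0// subr_gt0.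
  by rewrite -mulrBl !ler_pM2r//; split; nra.
have k0 : 0 <= k%:R / N%:R :> R by rewrite divr_ge0.
have -> : k.+1%:R ^+ 2 / N%:R =
    k%:R ^+ 2 / N%:R + k%:R / N%:R + k%:R / N%:R + N%:R^-1 :> R.
  by rewrite -natr1; field; rewrite gt_eqF.
have Ni : 0 < N%:R^-1 :> R by rewrite invr_gt0.
set pk := p ^+ k in IH0 IH1 *.
have -> : pk * p - q * a = (pk - q) * p + q * (p - a) by ring.
apply/andP; split; first by rewrite addr_ge0// mulr_ge0// subr_ge0.
have : (pk - q) * p <= pk - q by rewrite ler_piMr.
have : q * (p - a) <= p - a by rewrite ler_piMl// subr_ge0.
lra.
Qed.

(** Since the weights are nonnegative and add up to g x, replacing factorial
    moments by power moments costs at most g x times the uniform error of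
    ffact_ratio_bound. *)
Lemma bernstein_power_moment d g N k x : difference_monotonic g ->
  0 < d -> 0 < x -> (k <= N)%N -> (0 < N)%N ->
  `|\sum_(j < N.+1) ('C(N, j)%:R * iter (N - j) (bdiff d) g (x + j%:R * d))
     * (j%:R / N%:R) ^+ k - g (x + k%:R * d)| <= g x * (k%:R ^+ 2 / N%:R).
Proof.
move=> gdm d0 x0 kN N0.
have w0 (j : 'I_N.+1) :
  0 <= 'C(N, j)%:R * iter (N - j) (bdiff d) g (x + j%:R * d).
  by rewrite mulr_ge0// gdm// ltr_pwDl// mulr_ge0// ltW.
have Nk0 : (N ^_ k)%:R != 0 :> R by rewrite pnatr_eq0 -lt0n ffact_gt0.
have -> : g (x + k%:R * d) = \sum_(j < N.+1)
   ('C(N, j)%:R * iter (N - j) (bdiff d) g (x + j%:R * d))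
     * ((j ^_ k)%:R / (N ^_ k)%:R).
  under eq_bigr do rewrite mulrA.
  by rewrite -mulr_suml bernstein_factorial_moment// mulrAC divff// mul1r.
rewrite [g x](difference_newton d g N) -sumrB mulr_suml.
apply: le_trans (ler_norm_sum _ _ _) _; apply: ler_sum => j _.
rewrite -mulrBr normrM ger0_norm// ler_wpM2l//.
have /andP[r0 r1] := ffact_ratio_bound kN (ltn_ord j : (j <= N)%N) N0.
by rewrite ger0_norm.
Qed.

End Differences.

(** * Atomic measures approximating a Laplace transform *)

Section Atoms.
Variable R : realType.
Implicit Types (g : R -> R) (s : seq (R * R)) (t : R).

(** An element (w, y) of the sequence is an atom of mass w at the point y. *)
Definition laplace_atoms s t := \sum_(p <- s) p.1 * expR (- (t * p.2)).

Definition nonneg_atoms s := forall p, p \in s -> 0 <= p.1 /\ 0 <= p.2.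

Lemma laplace_atoms_nonincreasing s t u : nonneg_atoms s -> t <= u ->
  laplace_atoms s u <= laplace_atoms s t.
Proof.
move=> s0 tu; rewrite /laplace_atoms big_seq_cond [leRHS]big_seq_cond.
apply: ler_sum => p /andP[/s0[p1 p2] _].
by rewrite ler_wpM2l// ler_expR lerN2 ler_wpM2r.
Qed.

(** Base point and step are both 1 / (m + 1), and an atom j / N is moved to
    the half-line by j / N = e^(- y / (m + 1)); the atom j = 0 would sit at
    infinity and is dropped, which is harmless for k > 0. *)
Lemma bernstein_atoms g (m : nat) : difference_monotonic g ->
  exists s, nonneg_atoms s /\ forall k, (0 < k <= m.+1 ^ 3)%N ->
    `|laplace_atoms s (k%:R / m.+1%:R) - g (k.+1%:R / m.+1%:R)|
      <= k%:R ^+ 2 / m.+1%:R ^+ 3.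
Proof.
move=> gdm; set M := m.+1%:R : R.
have M0 : 0 < M by rewrite ltr0n.
have Mi0 : 0 < M^-1 by rewrite invr_gt0.
have g0 : 0 <= g M^-1 := gdm 0%N 1 _ ltr01 Mi0.
(* N is at least g (1 / M) * M ^ 3, which turns the error
   g (1 / M) * (k ^ 2 / N) into k ^ 2 / M ^ 3. *)
pose c := (Num.truncn (g M^-1)).+1; pose N := (c * m.+1 ^ 3)%N.
have gc : g M^-1 <= c%:R by rewrite ltW// truncnS_gt.
have N0 : (0 < N)%N by rewrite muln_gt0 expn_gt0.
have NR : 0 < N%:R :> R by rewrite ltr0n.
pose w j := 'C(N, j)%:R * iter (N - j) (bdiff M^-1) g (M^-1 + j%:R * M^-1).
pose y j := - (M * ln (j%:R / N%:R)) : R.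
exists [seq (w j, y j) | j <- index_iota 1 N.+1]; split.
  move=> _ /mapP[j + ->] /=; rewrite mem_index_iota ltnS => /andP[j0 jN].
  split; first by rewrite mulr_ge0// gdm// ltr_pwDl// mulr_ge0// ltW.
  rewrite oppr_ge0 pmulr_rle0// ln_le0// ler_pdivrMr// mul1r ler_nat//.
move=> k /andP[k0 kM].
have kN : (k <= N)%N by rewrite (leq_trans kM)// leq_pmull.
have -> : k.+1%:R / M = M^-1 + k%:R * M^-1 by rewrite -natr1; ring.
have -> : laplace_atoms [seq (w j, y j) | j <- index_iota 1 N.+1] (k%:R / M) =
    \sum_(j < N.+1) w j * (j%:R / N%:R) ^+ k.
  rewrite -(big_mkord xpredT (fun j => w j * (j%:R / N%:R) ^+ k)).
  rewrite big_ltn// mul0r expr0n gtn_eqF// mulr0 add0r.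
  rewrite /laplace_atoms big_map; apply: eq_big_nat => j /andP[j0 _] /=.
  rewrite /y mulrN opprK -(mulrA _ M^-1) mulKf ?gt_eqF//.
  by rewrite expRM_natl lnK// posrE divr_gt0// ltr0n.
apply: le_trans (bernstein_power_moment gdm Mi0 Mi0 kN N0) _.
rewrite mulrCA ler_wpM2l ?exprn_ge0//.
rewrite ler_pdivrMr// natrM natrX mulrCA mulVf ?mulr1//.
by rewrite expf_neq0// gt_eqF.
Qed.

Lemma difference_monotonic_nonincreasing g x y : difference_monotonic g ->
  0 < x -> x <= y -> g y <= g x.
Proof.
move=> gdm x0; rewrite le_eqVlt => /predU1P[->//|xy].
have := gdm 1%N (y - x) x; rewrite subr_gt0 => /(_ xy x0) /=.
by rewrite /bdiff subr_ge0 addrC subrK.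
Qed.

(** A real t is enclosed between consecutive multiples of 1 / (m + 1), at
    which the transform is within O(1 / m) of the value of g at the next
    multiple; both functions are nonincreasing, and g is continuous from the
    right. *)
Lemma bernstein_atoms_cvg g : difference_monotonic g ->
  (forall t, 0 < t -> g x @[x --> t^'+] --> g t) ->
  exists s_ : nat -> seq (R * R), (forall m, nonneg_atoms (s_ m)) /\
    forall t, 0 < t -> laplace_atoms (s_ m) t @[m --> \oo] --> g t.
Proof.
move=> gdm grc; have /choice[s_ sP] := fun m => bernstein_atoms m gdm.
exists s_; split=> [m|t t0]; first by case: (sP m).
have Mi (m : nat) : 0 < m.+1%:R^-1 :> R by rewrite invr_gt0.
apply: (@squeeze_cvgr _ _ _ _
  (fun m => g (t + 2 / m.+1%:R) - (t + m.+1%:R^-1) ^+ 2 * m.+1%:R^-1)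
  (fun m => g t + t ^+ 2 * m.+1%:R^-1)); last 2 first.
- rewrite -[X in _ --> X]subr0 -[X in _ - X](mulr0 ((t + 0) ^+ 2)).
  apply: cvgB; last first.
    apply: cvgM; last exact: cvg_harmonic.
    by apply: cvgM; (apply: cvgD; [exact: cvg_cst|exact: cvg_harmonic]).
  have /cvg_at_rightP := grc _ t0; apply; split=> [m|].
    by rewrite ltrDl mulr_gt0.
  rewrite -[X in _ --> X]addr0 -[X in _ + X](mulr0 2).
  by apply: cvgD; [exact: cvg_cst|apply: cvgM; [exact: cvg_cst|exact: cvg_harmonic]].
- rewrite -[X in _ --> X]addr0 -[X in _ + X](mulr0 (t ^+ 2)).
  by apply: cvgD; [exact: cvg_cst|apply: cvgM; [exact: cvg_cst|exact: cvg_harmonic]].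
near=> m; have [s0 sL] := sP m.
have tM : t^-1 <= m.+1%:R.
  by rewrite -[leRHS]natr1 ler_wpDr//; near: m; exact: nbhs_infty_ger.
have tM' : t <= m.+1%:R.
  by rewrite -[leRHS]natr1 ler_wpDr//; near: m; exact: nbhs_infty_ger.
have M3 : 3 <= m.+1%:R :> R.
  by rewrite -[leRHS]natr1 ler_wpDr//; near: m; exact: nbhs_infty_ger.
set M := m.+1%:R : R in tM tM' M3 *.
have M0 : 0 < M by rewrite ltr0n.
set k := Num.truncn (t * M).
have /andP[k1 k2] : k%:R <= t * M < k.+1%:R.
  by rewrite truncn_itv// mulr_ge0// ltW.
have k0 : (0 < k)%N.
  by rewrite truncn_gt0 mulrC -ler_pdivrMr// mul1r.
have kM : (k.+1 <= m.+1 ^ 3)%N.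
  rewrite -(ler_nat R) natrX -natr1 -/M !exprS expr0 mulr1.
  by nra.
have k1M : k%:R / M <= t by rewrite ler_pdivrMr.
have k2M : t <= k.+1%:R / M by rewrite ler_pdivlMr// ltW.
have k0' : 0 < k.+1%:R / M by rewrite divr_gt0.
have cube a : a ^+ 2 / M ^+ 3 = (a / M) ^+ 2 * M^-1.
  by field; rewrite gt_eqF.
rewrite -/M; apply/andP; split.
  have := sL k.+1 kM; rewrite -/M ler_norml => /andP[+ _].
  have := laplace_atoms_nonincreasing s0 k2M.
  have : g (t + 2 / M) <= g (k.+2%:R / M).
    apply: difference_monotonic_nonincreasing => //; first by rewrite divr_gt0.
    rewrite ler_pdivrMr// mulrDl divfK ?gt_eqF// -2!natr1.
    by move: k1; lra.
  have : k.+1%:R ^+ 2 / M ^+ 3 <= (t + M^-1) ^+ 2 * M^-1.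
    rewrite cube ler_pM2r ?invr_gt0// ler_sqr ?nnegrE ?(ltW k0')//; last first.
      by rewrite addr_ge0// ltW// invr_gt0.
    by rewrite -natr1 mulrDl mul1r lerD2r.
  move: ((t + _) ^+ 2 / M) (_ / M ^+ 3) (g (t + _)) (g (k.+2%:R / M)).
  by move=> a b c d *; lra.
have := sL k; rewrite k0 (ltnW kM) => /(_ isT).
rewrite -/M ler_norml => /andP[_].
have := laplace_atoms_nonincreasing s0 k1M.
have : g (k.+1%:R / M) <= g t.
  exact: difference_monotonic_nonincreasing.
have : k%:R ^+ 2 / M ^+ 3 <= t ^+ 2 * M^-1.
  rewrite cube ler_pM2r ?invr_gt0// ler_sqr ?nnegrE ?(ltW t0)//.
  by rewrite divr_ge0// ltW.
move: (t ^+ 2 / M) (_ / M ^+ 3) (g (k.+1%:R / M)) (laplace_atoms (s_ m) (k%:R / M)).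
by move=> a b c d *; lra.
Unshelve. all: by end_near. Qed.

End Atoms.

(** * Step approximation of the exponential, and limits along an ultrafilter *)

Section StepFunctions.
Variable R : realType.
Implicit Types (s : seq (R * R)) (t d y : R) (K i : nat).

Definition expR_decr t d i :=
  expR (- (t * (i%:R * d))) - expR (- (t * (i.+1%:R * d))).

(** The decreasing step function with jump expR_decr t d i after the grid
    point (i + 1) d; by telescoping, its value on the i-th cell is e^(- t i d)
    minus the constant e^(- t K d). *)
Definition expR_step t d K y : R :=
  \sum_(i < K) expR_decr t d i * (y <= i.+1%:R * d)%R%:R.

Lemma expR_decr_ge0 t d i : 0 <= t -> 0 <= d -> 0 <= expR_decr t d i.
Proof.
move=> t0 d0; rewrite subr_ge0 ler_expR lerN2 ler_wpM2l// ler_wpM2r//.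
by rewrite ler_nat.
Qed.

(** The jumps form a geometric sequence; this absorbs a shift by one grid
    step. *)
Lemma expR_decrS t d i : expR_decr t d i = expR (t * d) * expR_decr t d i.+1.
Proof.
rewrite /expR_decr mulrBr -!expRD -[i.+2%:R]natr1 -[i.+1%:R]natr1.
by congr (expR _ - expR _); ring.
Qed.

Lemma expR_step_ub t d K y : 0 <= t -> 0 <= d ->
  expR_step t d K y <= expR (t * d) * expR (- (t * y)).
Proof.
move=> t0 d0.
(* The telescoped form goes through the induction on K; the first alternative
   holds as long as K d < y. *)
suff : expR_step t d K y <= 0 \/ expR_step t d K y <=
    expR (t * d) * expR (- (t * y)) - expR (- (t * (K%:R * d))).
  case=> /le_trans; apply; first by rewrite mulr_ge0// expR_ge0.
  by rewrite gerBl expR_ge0.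
elim: K => [|K IH]; first by left; rewrite /expR_step big_ord0.
rewrite /expR_step big_ord_recr /= -/(expR_step t d K y).
have [yK|_] := leP y; last first.
  rewrite mulr0n mulr0 addr0; case: IH => IH; [by left|right].
  apply: le_trans IH _; rewrite lerD2l lerN2.
  by rewrite -subr_ge0 expR_decr_ge0.
rewrite mulr1n mulr1 /expR_decr; right; case: IH => IH; last by lra.
suff : expR (- (t * (K%:R * d))) <= expR (t * d) * expR (- (t * y)) by lra.
rewrite -expRD ler_expR; have := ler_wpM2l t0 yK.
by rewrite -natr1; lra.
Qed.

Lemma expR_step_lb t d K y : 0 <= t -> 0 <= d -> 0 <= y -> y <= K%:R * d ->
  expR (- (t * y)) <= expR_step t d K y + expR (- (t * (K%:R * d))).
Proof.
move=> t0 d0 y0; have st0 K' : 0 <= expR_step t d K' y.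
  by apply: sumr_ge0 => i _; rewrite mulr_ge0// expR_decr_ge0.
elim: K => [|K IH] yK.
  have -> : y = 0 by move: yK; rewrite mul0r; lra.
  by rewrite /expR_step big_ord0 add0r mul0r.
rewrite /expR_step big_ord_recr /= -/(expR_step t d K y) yK mulr1n mulr1.
rewrite /expR_decr; have [/IH|Ky] := leP y (K%:R * d); first by lra.
have := st0 K.
have : expR (- (t * y)) <= expR (- (t * (K%:R * d))).
  by rewrite ler_expR lerN2 ler_wpM2l// ltW.
lra.
Qed.

(** The constant missing from the step function below K d, and the whole
    exponential above it, are both controlled by giving away half of the
    exponent t y. The error term stays a Laplace transform, now at t / 2,
    hence is uniformly small. *)
Lemma expR_step_lb_tail t d K y : 0 <= t -> 0 <= d -> 0 <= y ->
  expR (- (t * y)) <= expR_step t d K y +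
    expR (- (t / 2 * (K%:R * d))) * expR (- (t / 2 * y)).
Proof.
move=> t0 d0 y0.
rewrite -expRD; have [yK|Ky] := leP y (K%:R * d).
  apply: (le_trans (expR_step_lb t0 d0 y0 yK)); rewrite lerD2l ler_expR.
  by nra.
rewrite ler_wpDl//.
  by apply: sumr_ge0 => i _; rewrite mulr_ge0// expR_decr_ge0.
by rewrite ler_expR; nra.
Qed.

Definition atoms_cdf s y : R := \sum_(p <- s) p.1 * (p.2 <= y)%R%:R.

Lemma atoms_cdf_step s t d K :
  \sum_(i < K) expR_decr t d i * atoms_cdf s (i.+1%:R * d) =
  \sum_(p <- s) p.1 * expR_step t d K p.2.
Proof.
under eq_bigr do rewrite mulr_sumr; rewrite exchange_big /=.
by apply: eq_bigr => p _; rewrite mulr_sumr; apply: eq_bigr => i _; rewrite mulrCA.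
Qed.

Lemma atoms_cdf_ub s t d K : nonneg_atoms s -> 0 <= t -> 0 <= d ->
  \sum_(i < K) expR_decr t d i * atoms_cdf s (i.+1%:R * d) <=
  expR (t * d) * laplace_atoms s t.
Proof.
move=> s0 t0 d0; rewrite atoms_cdf_step /laplace_atoms mulr_sumr.
rewrite big_seq_cond [leRHS]big_seq_cond; apply: ler_sum => p /andP[/s0[p1 p2] _].
by rewrite mulrCA ler_wpM2l// expR_step_ub.
Qed.

Lemma atoms_cdf_lb s t d K : nonneg_atoms s -> 0 <= t -> 0 <= d ->
  laplace_atoms s t <=
  \sum_(i < K) expR_decr t d i * atoms_cdf s (i.+1%:R * d) +
    expR (- (t / 2 * (K%:R * d))) * laplace_atoms s (t / 2).
Proof.
move=> s0 t0 d0; rewrite atoms_cdf_step /laplace_atoms mulr_sumr -big_split /=.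
rewrite big_seq_cond [leRHS]big_seq_cond; apply: ler_sum => p /andP[/s0[p1 p2] _].
by rewrite mulrCA -mulrDr ler_wpM2l// expR_step_lb_tail.
Qed.

Lemma atoms_cdf_ge0 s y : nonneg_atoms s -> 0 <= atoms_cdf s y.
Proof.
move=> s0; rewrite /atoms_cdf big_seq_cond.
by apply: sumr_ge0 => p /andP[/s0[p1 p2] _]; rewrite mulr_ge0.
Qed.

Lemma atoms_cdf_nondecreasing s : nonneg_atoms s ->
  {homo atoms_cdf s : x y / x <= y}.
Proof.
move=> s0 x y xy; rewrite /atoms_cdf big_seq_cond [leRHS]big_seq_cond.
apply: ler_sum => p /andP[/s0[p1 p2] _]; rewrite ler_wpM2l// ler_nat.
by have [px|] := leP p.2 x => //; rewrite (le_trans px xy).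
Qed.

Lemma atoms_cdf_lt0 s y : nonneg_atoms s -> y < 0 -> atoms_cdf s y = 0.
Proof.
move=> s0 y0; rewrite /atoms_cdf big_seq_cond big1// => p /andP[/s0[p1 p2] _].
by rewrite leNgt (lt_le_trans y0 p2) mulr0.
Qed.

(** This local bound is uniform along a sequence of atomic measures whose
    Laplace transforms converge at 1. *)
Lemma atoms_cdf_le_laplace s y : nonneg_atoms s ->
  atoms_cdf s y <= expR y * laplace_atoms s 1.
Proof.
move=> s0; rewrite /atoms_cdf /laplace_atoms mulr_sumr.
rewrite big_seq_cond [leRHS]big_seq_cond; apply: ler_sum => p /andP[/s0[p1 p2] _].
rewrite mulrCA ler_wpM2l// mul1r -expRD.
have [py|_] := leP p.2 y; last by rewrite mulr0n expR_ge0.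
by rewrite mulr1n -expR0 ler_expR subr_ge0.
Qed.

End StepFunctions.

Section VagueLimit.
Variable R : realType.
Implicit Types (s : seq (R * R)) (t d y : R) (K i : nat).

(** This replaces the extraction of a subsequence: a single ultrafilter makes
    all bounded sequences converge at once. *)
Lemma ultrafilter_cvg_bounded (U : set_system nat) (u : nat -> R) (a b : R) :
  UltraFilter U -> (\forall m \near U, a <= u m <= b) ->
  exists l : R, u m @[m --> U] --> l.
Proof.
move=> UU ub.
have UF : UltraFilter (fmap u U).
  split; first exact: fmap_proper_filter.
  move=> G GF UG; apply/seteqP; split=> A; last exact: UG.
  move=> GA; have [//|nA] := in_ultra_setVsetC (u @^-1` A) UU.
  have GnA : G (~` A) by apply: UG.
  by have /filter_ex[x []] := @filterI _ _ GF _ _ GA GnA.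
have := @segment_compact R a b; rewrite compact_ultra => /(_ _ UF)[].
  by apply: filterS ub => m mab; rewrite /= in_itv.
by move=> l [_ ul]; exists l.
Qed.

(** The limit of the distribution functions need not be right-continuous; what
    is kept of the Laplace transforms is a pair of inequalities on finite
    sums, which are closed conditions. *)
Lemma atoms_cdf_ultralimit (s_ : nat -> seq (R * R)) (g : R -> R) :
  (forall m, nonneg_atoms (s_ m)) ->
  (forall t, 0 < t -> laplace_atoms (s_ m) t @[m --> \oo] --> g t) ->
  exists G : R -> R, [/\ forall y, 0 <= G y,
    {homo G : x y / x <= y},
    forall y, y < 0 -> G y = 0,
    forall t d K, 0 < t -> 0 < d ->
    \sum_(i < K) expR_decr t d i * G (i.+1%:R * d) <= expR (t * d) * g t &
    forall t d K, 0 < t -> 0 < d -> g t <=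
      \sum_(i < K) expR_decr t d i * G (i.+1%:R * d) +
      expR (- (t / 2 * (K%:R * d))) * g (t / 2)].
Proof.
move=> s0 sg.
have [U [UU oU]] := @ultraFilterLemma nat \oo _.
have sgU t : 0 < t -> laplace_atoms (s_ m) t @[m --> U] --> g t.
  by move=> /sg; apply: cvg_trans; exact: (cvg_app _ oU).
have /choice[G GP] : forall y, exists l : R, atoms_cdf (s_ m) y @[m --> U] --> l.
  move=> y; apply: (@ultrafilter_cvg_bounded _ _ 0 (expR y * (g 1 + 1))) => //.
  have /cvgr_le/(_ (g 1 + 1)) := sgU 1 ltr01; rewrite ltrDl ltr01 => /(_ isT).
  apply: filterS => m sm; rewrite atoms_cdf_ge0//=.
  apply: le_trans (atoms_cdf_le_laplace _ (s0 m)) _.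
  by rewrite ler_wpM2l// expR_ge0.
have sumG t d K : \sum_(i < K) expR_decr t d i * atoms_cdf (s_ m) (i.+1%:R * d)
    @[m --> U] --> \sum_(i < K) expR_decr t d i * G (i.+1%:R * d).
  elim: K => [|K IH].
    by under eq_fun do rewrite big_ord0; rewrite big_ord0; exact: cvg_cst.
  under eq_fun do rewrite big_ord_recr /=; rewrite big_ord_recr /=.
  by apply: cvgD => //; apply: cvgM; [exact: cvg_cst|exact: GP].
exists G; split.
- move=> y; apply: (ler_cvg_to (cvg_cst 0) (GP y)).
  by apply: nearW => m; exact: atoms_cdf_ge0.
- move=> x y xy; apply: (ler_cvg_to (GP x) (GP y)).
  by apply: nearW => m; exact: atoms_cdf_nondecreasing.
- move=> y y0; apply: (cvg_unique _ (GP y)) => //.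
  apply: cvg_near_cst; apply: nearW => m; exact: atoms_cdf_lt0.
- move=> t d K t0 d0.
  apply: (ler_cvg_to (sumG t d K)).
    by apply: cvgM; [exact: cvg_cst|exact: sgU].
  by apply: nearW => m; rewrite atoms_cdf_ub// ltW.
- move=> t d K t0 d0.
  apply: (ler_cvg_to (sgU _ t0)).
    apply: cvgD; first exact: sumG.
    by apply: cvgM; [exact: cvg_cst|apply: sgU; rewrite divr_gt0].
  by apply: nearW => m; rewrite atoms_cdf_lb// ltW.
Qed.

End VagueLimit.

(** * The measure of a nondecreasing function *)

Section StieltjesMeasure.
Variable R : realType.

(** F is the right limit of G. The comparison F x <= G y for x < y is all that
    is needed later to return from F to G. *)
Lemma nondecreasing_cumulative (G : R -> R) : {homo G : x y / x <= y} ->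
  exists F : cumulative R R,
    (forall x, G x <= F x) /\ (forall x y, x < y -> F x <= G y).
Proof.
move=> Gnd; pose F x := inf [set G z | z in `]x, +oo[].
have Fn0 x : [set G z | z in `]x, +oo[] !=set0.
  by exists (G (x + 1)), (x + 1) => //=; rewrite in_itv /= andbT ltrDl.
have lbG x : lbound [set G z | z in `]x, +oo[] (G x).
  by move=> _ [z /= + <-]; rewrite in_itv /= andbT => /ltW; exact: Gnd.
have GF x : G x <= F x by apply: lb_le_inf; [exact: Fn0|exact: lbG].
have FG x y : x < y -> F x <= G y.
  move=> xy; apply: ge_inf; first by exists (G x); exact: lbG.
  by exists y => //=; rewrite in_itv /= andbT.
have Fnd : nondecreasing F.
  move=> x y xy; apply: lb_le_inf; first exact: Fn0.
  move=> _ [z /= + <-]; rewrite in_itv /= andbT => yz.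
  by apply: FG; exact: le_lt_trans yz.
have Frc : right_continuous F.
  move=> x; apply/cvgrPdist_le => e e0.
  have [_ [z /= + <-] Gz] : exists2 y, [set G z | z in `]x, +oo[] y & y < F x + e.
    by apply: inf_adherent => //; split; [exact: Fn0|exists (G x); exact: lbG].
  rewrite in_itv /= andbT => xz.
  near=> y; have xy : x < y by near: y; exact: nbhs_right_gt.
  have yz : y < z by near: y; exact: nbhs_right_lt.
  have := Fnd _ _ (ltW xy); have := FG _ _ yz.
  by rewrite ler_norml => ? ?; apply/andP; split; lra.
pose F' : cumulative R R := HB.pack F (isCumulative.Build R _ R F Fnd Frc).
by exists F'.
Unshelve. all: by end_near. Qed.

(** The Lebesgue-Stieltjes measure is naturally known on half-open intervals;
    since G vanishes on the negative half-line, ]-1, 0[ is negligible and the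
    closed interval [0, b] has measure F b. *)
Lemma halfline_cdf_measure (G : R -> R) : {homo G : x y / x <= y} ->
  (forall y, y < 0 -> G y = 0) ->
  exists (nu : {sigma_finite_measure set (measurableTypeR R) -> \bar R})
    (F : R -> R), [/\ forall b, 0 <= b -> nu `[0, b]%classic = (F b)%:E,
    forall x, G x <= F x & forall x y, x < y -> F x <= G y].
Proof.
move=> Gnd G0; have [F [GF FG]] := nondecreasing_cumulative Gnd.
have F0 x : x < 0 -> F x = 0.
  move=> x0; apply/eqP; rewrite eq_le; apply/andP; split.
    have x20 : x / 2 < 0 by lra.
    by rewrite -(G0 _ x20); apply: FG; lra.
  by rewrite -(G0 _ x0).
pose nu : {sigma_finite_measure set (measurableTypeR R) -> \bar R} :=
  lebesgue_stieltjes_measure F.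
exists nu, F; split=> // b b0.
have nuE x y : x <= y -> nu `]x, y]%classic = (F y - F x)%:E.
  move=> xy; rewrite /nu /= /lebesgue_stieltjes_measure /measure_extension /=.
  by rewrite measurable_mu_extE/= ?wlength_itv_bnd//; exact: is_ocitv.
have N10 : nu `]-1, 0[%classic = 0%E.
  have -> : `]-1, 0[%classic = \bigcup_n `](-1 : R), - n.+1%:R^-1]%classic.
    apply/seteqP; split=> x /=.
      rewrite in_itv /= => /andP[x1 x0].
      exists (Num.truncn (- x)^-1) => //=; rewrite in_itv /= x1 /=.
      rewrite lerNr invf_ple ?posrE ?oppr_gt0//.
      by rewrite ltW// truncnS_gt.
    move=> [n _] /=; rewrite !in_itv /= => /andP[-> xn] /=.
    by apply: (le_lt_trans xn); rewrite oppr_lt0 invr_gt0.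
  apply/eqP; rewrite eq_le measure_ge0 andbT.
  have mA n : measurable (`](-1 : R), - n.+1%:R^-1]%classic :
    set (measurableTypeR R)).
    exact: measurable_itv.
  apply: (le_trans (generalized_Boole_inequality nu mA _)).
    exact: bigcup_measurable.
  rewrite eseries0// => n _ _; apply: etrans (nuE _ _ _) _.
    by rewrite lerN2 invf_le1// ler1n.
  by rewrite !F0 ?subrr// oppr_lt0 invr_gt0.
have : nu `]-1, b]%classic = (F b)%:E.
  by rewrite nuE ?(F0 (-1)) ?subr0//; lra.
have -> : `]-1, b]%classic = `]-1, 0[%classic `|` `[0, b]%classic :> set R.
  by rewrite -itv_bndbnd_setU// bnd_simp; lra.
move=> <-; apply/esym.
apply: etrans (@measureU _ _ _ nu _ _ _ _ _) _ => //; last first.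
  by apply: (etrans (congr1 (fun z => z + _)%E N10)); rewrite add0e.
apply/seteqP; split=> // x [] /=; rewrite !in_itv /= => /andP[_ x0] /andP[x0' _].
by move: x0; rewrite ltNge x0'.
Qed.

End StieltjesMeasure.

(** * Bernstein's theorem *)

Section Bernstein.
Variable R : realType.
Implicit Types (t d : R).

Lemma cvg_expRN_muln (c : R) : 0 < c ->
  expR (- (K%:R * c)) @[K --> \oo] --> (0 : R).
Proof.
move=> c0; under eq_fun do rewrite -mulrN expRM_natl.
by apply: cvg_expr; rewrite ger0_norm ?expR_ge0// expR_lt1 oppr_lt0.
Qed.

Lemma le_expRM_limit (a b : R) : (forall d, 0 < d -> a <= expR d * b) -> a <= b.
Proof.
move=> ab; have h : expR (n.+1%:R^-1) * b @[n --> \oo] --> b.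
  rewrite -[X in _ --> X]mul1r; apply: cvgM; last exact: cvg_cst.
  rewrite -[X in _ --> X]expR0.
  exact: (cvg_comp _ _ (@cvg_harmonic R) (@continuous_expR R 0)).
apply: (ler_cvg_to (cvg_cst a) h).
by apply: nearW => n; apply: ab; rewrite invr_gt0.
Qed.

Lemma integral_expR_step (nu : {measure set (measurableTypeR R) -> \bar R})
    (F : R -> R) t d K : 0 <= t -> 0 <= d ->
  (forall b, 0 <= b -> nu `[0, b]%classic = (F b)%:E) ->
  (\int[nu]_(y in `[0%R, +oo[) (expR_step t d K y)%:E =
  (\sum_(i < K) expR_decr t d i * F (i.+1%:R * d))%:E)%E.
Proof.
move=> t0 d0 nuF.
have stepE y : (expR_step t d K y)%:E =
    (\sum_(i < K) (expR_decr t d i)%:E *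
      (\1_(`]-oo, i.+1%:R * d]%classic : set R) y)%:E)%E.
  rewrite /expR_step -sumEFin; apply: eq_bigr => i _; rewrite -EFinM indicE.
  congr (_ * _%:R)%:E; congr nat_of_bool.
  by apply/idP/idP; rewrite inE /= in_itv.
under eq_integral do rewrite stepE.
have mi (b : R) : measurable_fun (`[0, +oo[ : set (measurableTypeR R))
    (\1_(`]-oo, b]%classic : set R) : R -> R).
  exact: measurable_indic.
rewrite ge0_integral_sum//; last 2 first.
- by move=> i; apply: measurable_funeM; apply/measurable_EFinP; exact: mi.
- by move=> i y _; rewrite mule_ge0// lee_fin expR_decr_ge0.
rewrite -sumEFin; apply: eq_bigr => i _.
rewrite ge0_integralZl_EFin//; last 2 first.
- by apply/measurable_EFinP; exact: mi.
- exact: expR_decr_ge0.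
rewrite integral_indic//= EFinM; congr (_ * _)%E.
rewrite -nuF; last by rewrite mulr_ge0.
congr (nu _); apply/seteqP; split=> y /=; rewrite !in_itv /= andbT.
  by move=> [-> ->].
by move=> /andP[-> ->].
Qed.

Lemma measurable_expRN_lin (D : set R) t :
  measurable_fun D (fun y : R => (expR (- (t * y)))%:E).
Proof.
apply: measurable_funTS; apply/measurable_EFinP.
apply: measurableT_comp => //; apply: measurableT_comp => //.
Qed.

Lemma measurable_expR_step (D : set R) t d K :
  measurable_fun D (fun y : R => (expR_step t d K y)%:E).
Proof.
apply: measurable_funTS; apply/measurable_EFinP.
apply: measurable_sum => i; apply: measurable_funM => //.
rewrite (_ : (fun _ => _) = \1_(`]-oo, i.+1%:R * d]%classic : set R)).
  exact: measurable_indic.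
apply/funext => y; rewrite indicE; congr _%:R; congr nat_of_bool.
by apply/idP/idP; rewrite inE /= in_itv.
Qed.

(** On a grid of mesh d, replacing G by its regularisation F shifts the grid
    by one step, which costs a factor e^(t d). For fixed d the truncation
    error vanishes as K tends to infinity, and then d tends to 0. *)
Lemma laplace_atoms_limit (s_ : nat -> seq (R * R)) (g : R -> R) :
  (forall m, nonneg_atoms (s_ m)) ->
  (forall t, 0 < t -> laplace_atoms (s_ m) t @[m --> \oo] --> g t) ->
  exists nu : {sigma_finite_measure set (measurableTypeR R) -> \bar R},
    forall t, 0 < t ->
      (\int[nu]_(y in `[0%R, +oo[) (expR (- (t * y)))%:E = (g t)%:E)%E.
Proof.
move=> s0 sg; have [G [G0 Gnd Gneg Gub Glb]] := atoms_cdf_ultralimit s0 sg.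
have [nu [F [nuF GF FG]]] := halfline_cdf_measure Gnd Gneg.
exists nu => t t0; set L := LHS.
have L0 : (0 <= L)%E by apply: integral_ge0 => y _; rewrite lee_fin expR_ge0.
have c0 d i : 0 < d -> 0 <= expR_decr t d i.
  by move=> d0; rewrite expR_decr_ge0// ltW.
have Lub : (L <= (g t)%:E)%E.
  suff H d : 0 < d -> (L <= (expR (2 * t * d) * g t)%:E)%E.
    have Lf : L \is a fin_num.
      by rewrite ge0_fin_numE// (le_lt_trans (H _ ltr01))// ltry.
    rewrite -(fineK Lf) lee_fin; apply: le_expRM_limit => e e0.
    have d0 : 0 < e / (2 * t) by rewrite divr_gt0// mulr_gt0.
    have := H _ d0; rewrite -{1}(fineK Lf) lee_fin.
    by rewrite (mulrCA (2 * t)) divff ?mulr1// gt_eqF// mulr_gt0.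
  move=> d0.
  (* F ((i + 1) d) <= G ((i + 2) d), and the shifted sum is rewritten with
     expR_decrS. *)
  have FK K : \sum_(i < K) expR_decr t d i * F (i.+1%:R * d) <=
      expR (2 * t * d) * g t.
    rewrite (_ : 2 * t * d = t * d + t * d); last by ring.
    rewrite expRD -mulrA.
    apply: (@le_trans _ _ (expR (t * d) * \sum_(i < K.+1)
        expR_decr t d i * G (i.+1%:R * d))); last first.
      by rewrite ler_wpM2l ?expR_ge0// Gub.
    rewrite big_ord_recl mulrDr ler_wpDl//.
      by rewrite mulr_ge0 ?expR_ge0// mulr_ge0// c0.
    rewrite mulr_sumr; apply: ler_sum => i _; rewrite /= expR_decrS mulrA.
    rewrite ler_wpM2l ?mulr_ge0 ?expR_ge0 ?c0//.
    by apply: FG; rewrite ltr_pM2r// ltr_nat.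
  rewrite /L ge0_integral_ereal_sup//; last first.
    apply/measurable_EFinP; exact: measurable_expRN_lin.
  apply: ge_ereal_sup => _ [n _ <-].
  apply/lee_addgt0Pr => e e0.
  have F0 : 0 <= F n.+1%:R by rewrite (le_trans (G0 _) (GF _)).
  (* On [0, n + 1] the step function misses at most the constant e^(- t K d),
     whose integral becomes small for K large. *)
  have [K [nK Ke]] : exists K, n.+1%:R <= K%:R * d /\
      expR (- (t * (K%:R * d))) * F n.+1%:R <= e.
    have td0 : 0 < t * d by rewrite mulr_gt0.
    have cv : expR (- (K%:R * (t * d))) * F n.+1%:R @[K --> \oo] --> (0 : R).
      rewrite -[X in _ --> X](mul0r (F n.+1%:R)).
      by apply: cvgM; [exact: cvg_expRN_muln|exact: cvg_cst].
    have : \forall K \near \oo, n.+1%:R <= K%:R * d /\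
        expR (- (K%:R * (t * d))) * F n.+1%:R <= e.
      near=> K; split.
        by rewrite -ler_pdivrMr//; near: K; exact: nbhs_infty_ger.
      by near: K; move/cvgr_le : cv; apply.
    move=> /filter_ex[K [K1 K2]]; exists K; split=> //.
    by rewrite mulrCA.
  have mD : measurable (`[0, n.+1%:R]%classic : set (measurableTypeR R)).
    exact: measurable_itv.
  have st0 y : 0 <= expR_step t d K y.
    by apply: sumr_ge0 => i _; rewrite mulr_ge0// c0.
  apply: (@le_trans _ _ (\int[nu]_(y in `[0%R, n.+1%:R])
      ((expR_step t d K y)%:E + (expR (- (t * (K%:R * d))))%:E))%E).
    apply: ge0_le_integral => //.
    - exact: measurable_expRN_lin.
    - by apply: emeasurable_funD => //; exact: measurable_expR_step.
    - move=> y /=; rewrite in_itv /= => /andP[y0 yn].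
      by rewrite -EFinD lee_fin expR_step_lb ?(ltW t0) ?(ltW d0)// (le_trans yn).
  rewrite ge0_integralD//; last 2 first.
  - by move=> y _; rewrite lee_fin.
  - exact: measurable_expR_step.
  apply: leeD; last first.
    rewrite integral_cst//.
    apply: (@le_trans _ _
        ((expR (- (t * (K%:R * d))))%:E * (F n.+1%:R)%:E)%E).
      by apply: lee_wpmul2l; rewrite ?lee_fin ?expR_ge0// -nuF.
    by rewrite -EFinM lee_fin.
  apply: (@le_trans _ _ (\int[nu]_(y in `[0%R, +oo[) (expR_step t d K y)%:E)%E).
    apply: ge0_subset_integral => //.
    - exact: measurable_expR_step.
    - by move=> y _; rewrite lee_fin.
    - by move=> y /=; rewrite !in_itv /= => /andP[->].
  by rewrite (integral_expR_step _ _ _ nuF) ?(ltW t0) ?(ltW d0)// lee_fin.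
apply/eqP; rewrite eq_le Lub /=.
have Lf : L \is a fin_num by rewrite ge0_fin_numE// (le_lt_trans Lub)// ltry.
rewrite -(fineK Lf) lee_fin; apply: le_expRM_limit => e e0.
pose d := e / t; have d0 : 0 < d by rewrite divr_gt0.
have eE : e = t * d by rewrite /d mulrC divfK// gt_eqF.
have t2d0 : 0 < t / 2 * d by rewrite mulr_gt0// divr_gt0.
have cv : expR (t * d) * fine L + expR (- (K%:R * (t / 2 * d))) * g (t / 2)
    @[K --> \oo] --> expR (t * d) * fine L.
  rewrite -[X in _ --> X]addr0 -[X in _ + X](mul0r (g (t / 2))).
  apply: cvgD; first exact: cvg_cst.
  by apply: cvgM; [exact: cvg_expRN_muln|exact: cvg_cst].
rewrite eE; apply: (ler_cvg_to (cvg_cst (g t)) cv); apply: nearW => K.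
apply: (le_trans (Glb t d K t0 d0)); rewrite mulrCA lerD2r.
apply: (@le_trans _ _ (\sum_(i < K) expR_decr t d i * F (i.+1%:R * d))).
  by apply: ler_sum => i _; rewrite ler_wpM2l// c0.
rewrite -lee_fin -(integral_expR_step _ (ltW t0) (ltW d0) nuF) EFinM (fineK Lf).
rewrite /L -ge0_integralZl_EFin ?expR_ge0//; last exact: measurable_expRN_lin.
apply: ge0_le_integral => //.
- move=> y _; rewrite lee_fin.
  by apply: sumr_ge0 => i _; rewrite mulr_ge0// c0.
- exact: measurable_expR_step.
- by apply: measurable_funeM; exact: measurable_expRN_lin.
- by move=> y _; rewrite -EFinM lee_fin expR_step_ub// ltW.
Unshelve. all: by end_near. Qed.

Theorem bernstein_difference (g : R -> R) : difference_monotonic g ->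
  (forall t, 0 < t -> g x @[x --> t^'+] --> g t) ->
  exists nu : {sigma_finite_measure set (measurableTypeR R) -> \bar R},
    forall t, 0 < t ->
      (\int[nu]_(y in `[0%R, +oo[) (expR (- (t * y)))%:E = (g t)%:E)%E.
Proof.
move=> gdm grc; have [s_ [s0 sg]] := bernstein_atoms_cvg gdm grc.
exact: laplace_atoms_limit s0 sg.
Qed.

End Bernstein.

(** * Completely monotonic functions have nonnegative differences *)

Section CompletelyMonotonic.
Variable R : realType.
Implicit Types (g : R -> R) (d x : R).

Lemma is_derive_bdiff g d x (a b : R) : is_derive x (1 : R) g a ->
  is_derive (x + d) (1 : R) g b -> is_derive x (1 : R) (bdiff d g) (a - b).
Proof.
move=> D1 D2.
have Ds : is_derive x (1 : R) (fun z : R => z + d) 1.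
  rewrite -[X in is_derive _ _ _ X]addr0.
  by apply: (@is_deriveD _ _ _ id (cst d)).
have D3 := @is_derive1_comp _ g (fun z => z + d) x b 1 D2 Ds; rewrite mulr1 in D3.
exact: (is_deriveB D1 D3).
Qed.

(** Derivatives of g are only controlled on the open half-line, so that
    iterated derivatives of the difference are computed near positive points
    only. *)
Lemma derive1n_bdiff g d n : 0 < d ->
  (forall m x, 0 < x -> derivable (derive1n m g) x 1) ->
  forall x, 0 < x -> derive1n n (bdiff d g) x = bdiff d (derive1n n g) x.
Proof.
move=> d0 dg; elim: n => [//|n IH] x x0.
rewrite !derive1nS derive1E.
have -> : 'D_1 (derive1n n (bdiff d g)) x = 'D_1 (bdiff d (derive1n n g)) x.
  apply: near_eq_derive.
  by near=> z; apply: IH; near: z; exact: lt_nbhsr.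
have xd0 : 0 < x + d by rewrite addr_gt0.
have /derivableP D1 := dg n x x0.
have /derivableP D2 := dg n (x + d) xd0.
have D3 := is_derive_bdiff D1 D2.
by rewrite derive_val /bdiff !derive1E.
Unshelve. all: by end_near. Qed.

(** The derivative of (-1) ^ n g^(n) is the opposite of
    (-1) ^ (n + 1) g^(n + 1), hence nonpositive. *)
Lemma completely_monotonic_derive1n_le g n x y : completely_monotonic g ->
  0 < x -> x <= y -> (-1) ^+ n * derive1n n g y <= (-1) ^+ n * derive1n n g x.
Proof.
move=> gcm x0; rewrite le_eqVlt => /predU1P[->//|xy].
have dg z : z \in `[x, y] -> derivable (derive1n n g) z 1.
  by rewrite in_itv /= => /andP[xz _]; apply: (gcm n z _).1; exact: lt_le_trans xz.
have cg : {within `[x, y], continuous (derive1n n g)}.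
  by apply: derivable_within_continuous => z /dg.
have [c cxy E] : exists2 c, c \in `]x, y[%R &
    derive1n n g y - derive1n n g x = derive1n n.+1 g c * (y - x).
  apply: MVT => // z zxy; rewrite derive1nS derive1E; apply/derivableP/dg.
  by move: zxy; rewrite !in_itv /= => /andP[/ltW -> /ltW ->].
rewrite -subr_le0 -mulrBr E mulrA.
have c0 : 0 < c by move: cxy; rewrite in_itv /= => /andP[/(lt_trans x0)].
rewrite pmulr_lle0 ?subr_gt0//.
by have := (gcm n.+1 c c0).2; rewrite exprS mulN1r mulNr oppr_ge0.
Qed.

Lemma completely_monotonic_bdiff g d : 0 < d -> completely_monotonic g ->
  completely_monotonic (bdiff d g).
Proof.
move=> d0 gcm n x x0.
have dg m z : 0 < z -> derivable (derive1n m g) z 1 by move=> /(gcm m)[].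
have xd0 : 0 < x + d by rewrite addr_gt0.
split; last first.
  rewrite derive1n_bdiff// /bdiff mulrBr subr_ge0.
  by apply: completely_monotonic_derive1n_le => //; rewrite lerDl ltW.
apply: (@near_eq_derivable _ _ _ (bdiff d (derive1n n g))).
  near=> z; apply/esym/derive1n_bdiff => //; near: z; exact: lt_nbhsr.
have /derivableP D1 := dg n x x0.
have /derivableP D2 := dg n (x + d) xd0.
by have [] := is_derive_bdiff D1 D2.
Unshelve. all: by end_near. Qed.

Lemma completely_monotonic_difference g :
  completely_monotonic g -> difference_monotonic g.
Proof.
move=> gcm n d x d0 x0.
have : completely_monotonic (iter n (bdiff d) g).
  by elim: n => // n IH; exact: completely_monotonic_bdiff.
by move=> /(_ 0%N x x0)[_]; rewrite expr0 mul1r.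
Qed.

End CompletelyMonotonic.

(** * Dilations and an integral with a power singularity *)

Section Scaling.
Variable R : realType.
Notation mu := (@lebesgue_measure R).

(** Lebesgue measure is c times its image under x |-> c x, as both give the
    same mass to half-open intervals. *)
Lemma ge0_integral_dilation (c : R) (D : set R) (f : R -> \bar R) : 0 < c ->
  measurable D -> measurable_fun D f -> (forall y, D y -> (0 <= f y)%E) ->
  (\int[mu]_(y in D) f y =
   c%:E * \int[mu]_(x in [set x | D (c * x)%R]) f (c * x)%R)%E.
Proof.
move=> c0 mD mf f0.
have mc : measurable_fun setT (fun x : R => c * x : measurableTypeR R).
  exact: mulrl_measurable.
pose k : {nonneg R} := NngNum (ltW c0).
have [pm [pmA pmI]] : exists pm : {measure set (measurableTypeR R) -> \bar R},
    (forall A, pm A = mu [set x | A (c * x)]) /\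
    (\int[pm]_(y in D) f y = \int[mu]_(x in [set x | D (c * x)%R]) f (c * x)%R)%E.
  unshelve refine (ex_intro _ (pushforward mu
    (fun x : R => c * x : measurableTypeR R) : {measure set _ -> \bar R}) _).
    exact: mc.
  split=> //; rewrite ge0_integral_pushforward// => y; rewrite inE; exact: f0.
pose m := mscale k pm.
have mE A : measurable A -> mu A = m A.
  apply: lebesgue_measure_unique => _ [[a b] _ <-].
  apply: etrans _ (congr1 (fun z => c%:E * z)%E (esym (pmA _))).
  have -> : [set x | `]a, b]%classic (c * x)] = `]a / c, b / c]%classic.
    apply/seteqP; split=> x /=; rewrite !in_itv /= ltr_pdivrMr// ler_pdivlMr//;
      by rewrite [x * c]mulrC.
  rewrite !lebesgue_measure_itv /= !lte_fin ltr_pM2r ?invr_gt0//.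
  case: ifPn => _; last by rewrite mule0.
  by rewrite -!EFinB -EFinM -mulrBl mulrC divfK// gt_eqF.
rewrite (@eq_measure_integral _ _ _ _ m mu)//; last by move=> A mA _; exact: mE.
by rewrite ge0_integral_mscale//= pmI.
Qed.

End Scaling.

Section Gamma.
Variable R : realType.
Notation mu := (@lebesgue_measure R).
Implicit Types (a b c s t x z : R).

Lemma measurable_powR_expRN (D : set R) a c :
  measurable_fun D (fun s : R => s `^ a * expR (- (c * s))).
Proof.
apply: measurable_funTS; apply: measurable_funM; first exact: measurable_powR.
apply: measurableT_comp => //; apply: measurableT_comp => //.
Qed.

(** From ln u <= u - 1 at u = s / b. *)
Lemma powR_le_expR b : 0 < b ->
  exists C, forall s, 0 < s -> s `^ b <= C * expR s.
Proof.
move=> b0; exists (expR (b * ln b - b)) => s s0.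
rewrite /powR gt_eqF// -expRD ler_expR.
have sb0 : 0 < s / b by rewrite divr_gt0.
have : ln (s / b) <= s / b - 1.
  rewrite -[in X in X <= _](subrKC 1 (s / b)) le_ln1Dx//.
  by rewrite -subr_gt0 opprK subrK.
rewrite lnM ?posrE ?invr_gt0// lnV ?posrE// => H.
have := ler_wpM2l (ltW b0) H.
have -> : b * (s / b - 1) = s - b by field; rewrite gt_eqF.
lra.
Qed.

Lemma measurable_powR_logistic (D : set R) a :
  measurable_fun D (fun s => (a * s `^ (a - 1) / (1 + s `^ a) ^+ 2)%:E).
Proof.
apply: measurable_funTS; apply/measurable_EFinP; apply: measurable_funM.
  by apply: measurable_funM => //; exact: measurable_powR.
rewrite (_ : (fun _ => _) = fun s => (1 + s `^ a) `^ (- 2%:R)); last first.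
  by apply/funext => s; rewrite powR_invn// addr_ge0// powR_ge0.
apply: (measurableT_comp (measurable_powR _)).
by apply: measurable_funD => //; exact: measurable_powR.
Qed.

(** The integrand is the derivative of - 1 / (1 + s ^ a), which increases from
    -1 to 0. For a > 0 of any size it is comparable to s ^ (a - 1) near 0, and
    it dominates s ^ (a - 1) e^(- s) up to a constant, so that the singularity
    at 0 and the tail are treated together. *)
Lemma integral_powR_logistic a : 0 < a ->
  (\int[mu]_(s in `]0%R, +oo[) (a * s `^ (a - 1) / (1 + s `^ a) ^+ 2)%:E <= 1)%E.
Proof.
move=> a0.
pose F (n : nat) : set R := `[n.+2%:R^-1, n.+2%:R]%classic.
pose f s := a * s `^ (a - 1) / (1 + s `^ a) ^+ 2.
pose G s := - (1 + s `^ a)^-1.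
have p0 s : 0 < 1 + s `^ a by rewrite ltr_pwDl// powR_ge0.
have FE : `]0%R, +oo[%classic = \bigcup_n F n.
  apply/seteqP; split=> s /=.
    rewrite in_itv /= andbT => s0.
    exists (Num.truncn s + Num.truncn s^-1)%N => //; rewrite /F /= in_itv /=.
    apply/andP; split.
      rewrite invf_ple ?posrE//; apply/ltW/(lt_le_trans (truncnS_gt _)).
      by rewrite ler_nat ltnS leqW// leq_addl.
    apply/ltW/(lt_le_trans (truncnS_gt _)).
    by rewrite ler_nat ltnS leqW// leq_addr.
  move=> [n _]; rewrite /F /= !in_itv /= andbT => /andP[+ _].
  by apply: lt_le_trans; rewrite invr_gt0.
have dG s : 0 < s -> is_derive s (1 : R) G (f s).
  move=> s0.
  have dp : is_derive s (1 : R) (fun u => 1 + u `^ a) (a * s `^ (a - 1)).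
    have sI : s \in `]0, +oo[%R by rewrite in_itv /= s0.
    have /derivableP D := @derivable_powR R 1 a s sI.
    rewrite -derive1E (powR_derive1 _ sI) in D.
    by have := is_deriveD (is_derive_cst (1 : R) s (1 : R)) D; rewrite add0r.
  have H := is_deriveN
    (@is_deriveV R (fun u => 1 + u `^ a) s _ 1 (lt0r_neq0 (p0 s)) dp).
  apply: (is_derive_eq H); rewrite /f.
  by rewrite scaleNr opprK /GRing.scale /= mulrC.
have cp b s : 0 < s -> {for s, continuous (fun u : R => u `^ b)}.
  move=> s0; apply: differentiable_continuous; apply/derivable1_diffP.
  by apply: derivable_powR; rewrite in_itv /= s0.
have cf s : 0 < s -> {for s, continuous f}.
  move=> s0; have c1 : {for s, continuous (fun u : R => 1 + u `^ a)}.
    by apply: cvgD; [exact: cvg_cst|exact: cp].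
  apply: cvgM; first by apply: cvgM; [exact: cvg_cst|exact: cp].
  apply: cvgV; first by rewrite expf_neq0// lt0r_neq0.
  by apply: cvgM; exact: c1.
have cG s : 0 < s -> {for s, continuous G}.
  move=> s0; apply: differentiable_continuous; apply/derivable1_diffP.
  by have [] := dG s s0.
have Fle n : (\int[mu]_(s in F n) (f s)%:E <= 1)%E.
  have n1 : n.+2%:R^-1 < n.+2%:R :> R.
    by rewrite (@lt_trans _ _ 1) ?invf_lt1 ?ltr1n.
  have n0 : 0 < n.+2%:R^-1 :> R by rewrite invr_gt0.
  rewrite /F (@continuous_FTC2 _ f G)//.
  - rewrite -EFinB lee_fin /G opprK.
    have := p0 n.+2%:R; rewrite -invr_gt0.
    suff : (1 + n.+2%:R^-1 `^ a)^-1 <= 1 :> R by lra.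
    by rewrite invf_le1// lerDl powR_ge0.
  - apply: continuous_in_subspaceT => s; rewrite inE /= in_itv /= => /andP[sn _].
    by apply: cf; exact: lt_le_trans sn.
  - split.
    + move=> s; rewrite in_itv /= => /andP[sn _].
      by have [] := dG s (lt_trans n0 sn).
    + exact/cvg_at_right_filter/cG.
    + exact/cvg_at_left_filter/cG/(lt_trans n0).
  - move=> s; rewrite in_itv /= => /andP[sn _]; rewrite derive1E.
    by have [_ ->] := dG s (lt_trans n0 sn).
have mf D : measurable_fun D (fun s => (f s)%:E) by exact: measurable_powR_logistic.
rewrite FE.
have Fcvg : (\int[mu]_(s in F n) (f s)%:E @[n --> \oo] -->
    \int[mu]_(s in \bigcup_n F n) (f s)%:E)%E.
  apply: ge0_nondecreasing_set_cvg_integral => //.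
  - move=> m n mn; apply/subsetPset => s; rewrite /F /= !in_itv /= => /andP[ms sm].
    apply/andP; split; last by rewrite (le_trans sm)// ler_nat.
    by rewrite (le_trans _ ms)// lef_pV2 ?posrE// ler_nat.
  - by move=> n; exact: measurable_itv.
  - by move=> n; exact: mf.
  - move=> n s _; rewrite lee_fin /f divr_ge0 ?sqr_ge0//.
    by rewrite mulr_ge0 ?powR_ge0// ltW.
have /cvg_lim <- := Fcvg => //.
apply: lime_le; first by apply/cvg_ex; eexists; exact: Fcvg.
by apply: nearW => n; exact: Fle.
Qed.

End Gamma.

(** * The Gamma integrals *)

Section GammaIntegrals.
Variable R : realType.
Notation mu := (@lebesgue_measure R).
Implicit Types (a b c s t x z : R).

Lemma measurable_powR_expRN1 (D : set R) a :
  measurable_fun D (fun s : R => s `^ a * expR (- s)).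
Proof.
have := @measurable_powR_expRN R D a 1.
by under eq_fun do rewrite mul1r.
Qed.

(** Domination by the integrand of integral_powR_logistic, because
    (1 + s ^ a) ^ 2 * e^(- s) is bounded. *)
Lemma integrable_powR_expRN a : 0 < a ->
  mu.-integrable `]0, +oo[ (fun s => (s `^ (a - 1) * expR (- s))%:E).
Proof.
move=> a0; have [C HC] := powR_le_expR (mulr_gt0 (ltr0n R 2) a0).
apply/integrableP; split; first by apply/measurable_EFinP;
  exact: measurable_powR_expRN1.
pose f s := a * s `^ (a - 1) / (1 + s `^ a) ^+ 2.
pose M := (2 + 2 * `|C|) / a.
have M0 : 0 <= M by rewrite divr_ge0 ?(ltW a0)// addr_ge0// mulr_ge0.
apply: (@le_lt_trans _ _ (\int[mu]_(s in `]0%R, +oo[) (M%:E * (f s)%:E)))%E.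
  apply: ge0_le_integral => //.
  - by apply: measurableT_comp => //; apply/measurable_EFinP;
      exact: measurable_powR_expRN1.
  - apply: measurable_funeM; exact: measurable_powR_logistic.
  move=> s; rewrite /= in_itv /= andbT => s0.
  rewrite ger0_norm ?mulr_ge0 ?powR_ge0 ?expR_ge0// -EFinM lee_fin.
  have p0 : 0 < 1 + s `^ a by rewrite ltr_pwDl// powR_ge0.
  rewrite /M /f [leRHS](_ : _ = s `^ (a - 1) *
    ((2 + 2 * `|C|) / (1 + s `^ a) ^+ 2)); last first.
    by field; rewrite !gt_eqF.
  rewrite ler_wpM2l ?powR_ge0// ler_pdivlMr ?exprn_gt0//.
  have q : (1 + s `^ a) ^+ 2 <= 2 + 2 * (s `^ a) ^+ 2.
    by have := sqr_ge0 (1 - s `^ a); move: (s `^ a) => u; lra.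
  apply: (@le_trans _ _ (expR (- s) * (2 + 2 * (s `^ a) ^+ 2))).
    by rewrite ler_wpM2l// expR_ge0.
  have e1 : expR (- s) <= 1 by rewrite -expR0 ler_expR oppr_le0 ltW.
  have sq : (s `^ a) ^+ 2 = s `^ (2 * a).
    by rewrite mulrC powRrM powR_mulrn ?powR_ge0.
  have := HC s s0; rewrite -sq => H.
  have e0 := expR_ge0 (- s).
  have H2 : expR (- s) * (s `^ a) ^+ 2 <= C.
    rewrite expRN mulrC ler_pdivrMr ?expR_gt0//.
  have := ler_norm C.
  lra.
rewrite ge0_integralZl_EFin//; last 2 first.
- move=> s _; rewrite lee_fin /f divr_ge0 ?sqr_ge0//.
  by rewrite mulr_ge0 ?powR_ge0// ltW.
- exact: measurable_powR_logistic.
apply: (@le_lt_trans _ _ (M%:E * 1))%E; last by rewrite mule1 ltry.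
by apply: lee_wpmul2l => //; exact: integral_powR_logistic.
Qed.

(** Euler's Gamma function. *)
Definition gamma_value a : R :=
  \int[mu]_(s in `]0, +oo[) (s `^ (a - 1) * expR (- s)).

Lemma gamma_valueE a : 0 < a -> (gamma_value a)%:E =
  (\int[mu]_(s in `]0%R, +oo[) (s `^ (a - 1) * expR (- s))%:E)%E.
Proof.
by move=> a0; rewrite /gamma_value /Rintegral fineK//;
  exact: integrable_fin_num (integrable_powR_expRN a0).
Qed.

Lemma gamma_value_ge0 a : 0 <= gamma_value a.
Proof. by apply: Rintegral_ge0 => s _; rewrite mulr_ge0 ?powR_ge0 ?expR_ge0. Qed.

(** The common source of the scaling rules for the complete and the incomplete
    Gamma functions; the interval lies in the half-line because powR is not
    homogeneous at negative arguments. *)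
Lemma powR_expRN_dilation b c (i : interval R) :
  0 < c -> {subset i <= `]0, +oo[} ->
  (\int[mu]_(s in [set` i]) (s `^ (b - 1) * expR (- s))%:E =
   (c `^ b)%:E * \int[mu]_(s in [set x | [set` i] (c * x)%R])
     (s `^ (b - 1) * expR (- (c * s)))%:E)%E.
Proof.
move=> c0 i0.
have mS : measurable [set x | [set` i] (c * x)%R].
  rewrite -[X in measurable X]setTI.
  have := @mulrl_measurable R setT c; exact.
rewrite (ge0_integral_dilation c0)//; last 2 first.
- by apply/measurable_EFinP; exact: measurable_powR_expRN1.
- by move=> s _; rewrite lee_fin mulr_ge0 ?powR_ge0 ?expR_ge0.
rewrite [X in (_ * X = _)%E](_ : _ = \int[mu]_(s in [set x | [set` i] (c * x)%R])
  ((c `^ (b - 1))%:E * (s `^ (b - 1) * expR (- (c * s)))%:E))%E; last first.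
  apply: eq_integral => s; rewrite inE /= => /i0;
    rewrite in_itv /= andbT pmulr_rgt0// => s0.
  by rewrite -EFinM powRM ?(ltW c0) ?(ltW s0)// mulrA.
rewrite ge0_integralZl_EFin ?powR_ge0//; last 2 first.
- by move=> s _; rewrite lee_fin mulr_ge0 ?powR_ge0 ?expR_ge0.
- by apply/measurable_EFinP; exact: measurable_powR_expRN.
rewrite muleA -EFinM; congr (_%:E * _)%E.
rewrite -{1}(@powRr1 _ c) ?ltW// -powRD; last by rewrite (gt_eqF c0) implybT.
by rewrite subrKC.
Qed.

Lemma laplace_powR a c : 0 < a -> 0 < c ->
  (\int[mu]_(s in `]0%R, +oo[) (s `^ (a - 1) * expR (- (c * s)))%:E =
   ((c `^ a)^-1 * gamma_value a)%:E)%E.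
Proof.
move=> a0 c0; rewrite EFinM gamma_valueE// (@powR_expRN_dilation a c)//.
rewrite muleA -EFinM mulVf ?mul1e ?gt_eqF ?powR_gt0//.
congr (integral _ _ _); apply/seteqP; split=> s /=; rewrite !in_itv /= !andbT.
  by move=> s0; rewrite mulr_gt0.
by rewrite pmulr_rgt0.
Qed.

(** incomplete_gamma is a real-valued integral, with a default value when the
    integral is infinite; it is finite by integrable_powR_expRN. *)
Lemma incomplete_gamma_EFin b z : 0 < b -> (incomplete_gamma b z)%:E =
  (\int[mu]_(s in `]0%R, z[) (s `^ (b - 1) * expR (- s))%:E)%E.
Proof.
move=> b0; rewrite /incomplete_gamma /Rintegral fineK//.
apply: integrable_fin_num => //.
apply: integrableS (integrable_powR_expRN b0) => //.
by move=> s /=; rewrite !in_itv /= => /andP[->].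
Qed.

Lemma incomplete_gammaE b x t : 0 < b -> 0 < x -> (incomplete_gamma b (x * t))%:E =
  ((x `^ b)%:E *
   \int[mu]_(s in `]0%R, t[) (s `^ (b - 1) * expR (- (x * s)))%:E)%E.
Proof.
move=> b0 x0; rewrite incomplete_gamma_EFin// (@powR_expRN_dilation b x)//;
  last first.
  by move=> s; rewrite !in_itv /= => /andP[->].
congr (_ * integral _ _ _)%E; apply/seteqP; split=> s /=; rewrite !in_itv /=.
  by rewrite pmulr_rgt0// ltr_pM2l.
by rewrite pmulr_rgt0// ltr_pM2l.
Qed.

Lemma incomplete_gamma_ge0 b z : 0 <= incomplete_gamma b z.
Proof. by apply: Rintegral_ge0 => s _; rewrite mulr_ge0 ?powR_ge0 ?expR_ge0. Qed.

Lemma incomplete_gamma_le b : 0 < b ->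
  {homo incomplete_gamma b : x y / x <= y}.
Proof.
move=> b0 x y xy; rewrite -lee_fin !incomplete_gamma_EFin//.
apply: ge0_subset_integral => //.
- by apply/measurable_EFinP; exact: measurable_powR_expRN1.
- by move=> s _; rewrite lee_fin mulr_ge0 ?powR_ge0 ?expR_ge0.
- by move=> s /=; rewrite !in_itv /= => /andP[-> sx]; exact: lt_le_trans xy.
Qed.

(** On ]z / 2, z[ the integrand s ^ b / s * e^(- s) is at least
    (z / 2) ^ b / z * e^(- z). *)
Lemma incomplete_gamma_gt0 b z : 0 < b -> 0 < z -> 0 < incomplete_gamma b z.
Proof.
move=> b0 z0; pose m := ((z / 2) `^ b / z) * expR (- z).
have z20 : 0 < z / 2 by rewrite divr_gt0.
have m0 : 0 < m by rewrite mulr_gt0 ?expR_gt0// divr_gt0// powR_gt0.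
apply: (@lt_le_trans _ _ (m * (z / 2))); first by rewrite mulr_gt0.
rewrite -lee_fin incomplete_gamma_EFin//.
have <- : (\int[mu]_(s in `](z / 2)%R, z[) m%:E = (m * (z / 2))%:E)%E.
  rewrite integral_cst//= lebesgue_measure_itv /= lte_fin ifT; last lra.
  by rewrite -EFinD -EFinM (_ : z - z / 2 = z / 2)//; field.
apply: (@le_trans _ _ (\int[mu]_(s in `](z / 2)%R, z[)
    (s `^ (b - 1) * expR (- s))%:E)%E).
  apply: ge0_le_integral => //.
  - by move=> s _; rewrite lee_fin ltW.
  - by apply/measurable_EFinP; exact: measurable_powR_expRN1.
  - move=> s /=; rewrite in_itv /= => /andP[s1 s2]; rewrite lee_fin.
    have s0 : 0 < s by exact: lt_trans s1.
    apply: ler_pM; rewrite ?expR_ge0//.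
    + by rewrite divr_ge0 ?powR_ge0// ltW.
    + rewrite powRB; last by rewrite (gt_eqF s0) implybT.
      rewrite powRr1 ?(ltW s0)//.
      apply: ler_pM; rewrite ?powR_ge0 ?invr_ge0 ?(ltW z0)//.
        by rewrite ge0_ler_powR ?nnegrE// ltW.
      by rewrite lef_pV2 ?posrE// ltW.
    + by rewrite ler_expR lerN2 ltW.
apply: ge0_subset_integral => //.
- by apply/measurable_EFinP; exact: measurable_powR_expRN1.
- by move=> s _; rewrite lee_fin mulr_ge0 ?powR_ge0 ?expR_ge0.
- by move=> s /=; rewrite !in_itv /= => /andP[/(lt_trans z20) -> ->].
Qed.

(** After scaling to ]0, 1[, the factor e^(- z s) is at most 1 <= e * e^(- s).
    *)
Lemma incomplete_gamma_ub b z : 0 < b -> 0 < z ->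
  incomplete_gamma b z <= expR 1 * incomplete_gamma b 1 * z `^ b.
Proof.
move=> b0 z0; rewrite mulrC -lee_fin -{1}[z]mulr1 incomplete_gammaE// EFinM.
apply: lee_wpmul2l; first by rewrite lee_fin powR_ge0.
rewrite EFinM incomplete_gamma_EFin// -ge0_integralZl_EFin ?expR_ge0//; last 2 first.
- by move=> s _; rewrite lee_fin mulr_ge0 ?powR_ge0 ?expR_ge0.
- by apply/measurable_EFinP; exact: measurable_powR_expRN1.
apply: ge0_le_integral => //.
- by move=> s _; rewrite lee_fin mulr_ge0 ?powR_ge0 ?expR_ge0.
- by apply/measurable_EFinP; exact: measurable_powR_expRN.
- apply: measurable_funeM; by apply/measurable_EFinP; exact: measurable_powR_expRN1.
move=> s /=; rewrite in_itv /= => /andP[s0 s1].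
rewrite -EFinM lee_fin mulrCA ler_wpM2l ?powR_ge0// -expRD ler_expR.
by nra.
Qed.

End GammaIntegrals.

(** * Tonelli's theorem on a rectangle, and mixtures of dilations *)

Section Tonelli.
Context d1 d2 (T1 : measurableType d1) (T2 : measurableType d2) (R : realType).
Variables (m1 : {sigma_finite_measure set T1 -> \bar R})
  (m2 : {sigma_finite_measure set T2 -> \bar R}).

Lemma ge0_integral_exchange (D1 : set T1) (D2 : set T2) (f : T1 * T2 -> \bar R) :
  measurable D1 -> measurable D2 -> measurable_fun setT f ->
  (forall z, 0 <= f z)%E ->
  (\int[m1]_(x in D1) \int[m2]_(y in D2) f (x, y) =
   \int[m2]_(y in D2) \int[m1]_(x in D1) f (x, y))%E.
Proof.
move=> mD1 mD2 mf f0.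
pose F z := (f z * (\1_(D1 `*` D2) z)%:E)%E.
have FE x y : F (x, y) = if (x \in D1) && (y \in D2) then f (x, y) else 0%E.
  rewrite /F indicE in_setX; case: ifPn => _; first by rewrite mule1.
  by rewrite mule0.
have mF : measurable_fun setT F.
  apply: emeasurable_funM => //; apply/measurable_EFinP.
  by apply: measurable_indic; exact: measurableX.
have F0 z : (0 <= F z)%E by rewrite mule_ge0// lee_fin.
have -> : (\int[m1]_(x in D1) \int[m2]_(y in D2) f (x, y) =
    \int[m1]_x \int[m2]_y F (x, y))%E.
  rewrite integral_mkcond; apply: eq_integral => x _; rewrite /patch.
  case: ifPn => xD; last by rewrite integral0_eq// => y _; rewrite FE (negbTE xD).
  by rewrite integral_mkcond; apply: eq_integral => y _; rewrite /patch FE xD.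
rewrite fubini_tonelli//.
rewrite [RHS]integral_mkcond; apply: eq_integral => y _; rewrite /patch.
case: ifPn => yD; last by rewrite integral0_eq// => x _;
  rewrite FE (negbTE yD) andbF.
by rewrite [RHS]integral_mkcond; apply: eq_integral => x _;
  rewrite /patch FE yD andbT.
Qed.

End Tonelli.

Section TailMean.
Variable R : realType.
Notation mu := (@lebesgue_measure R).
Implicit Types (alpha lambda s t x d : R) (psi phi : R -> R).

Lemma completely_monotonic_measurable psi : completely_monotonic psi ->
  measurable_fun (`]0, +oo[ : set R) psi.
Proof.
move=> pcm; apply: open_continuous_measurable_fun => //.
move=> s; rewrite inE /= in_itv /= andbT => s0.
apply: differentiable_continuous; apply/derivable1_diffP.
exact: (pcm 0%N s s0).1.
Qed.

Lemma completely_monotonic_ge0 psi s : completely_monotonic psi -> 0 < s ->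
  0 <= psi s.
Proof. by move=> pcm s0; have := (pcm 0%N s s0).2; rewrite expr0 mul1r. Qed.

Lemma measurable_tail_mean psi alpha s : completely_monotonic psi -> 0 < s ->
  measurable_fun (`]1, +oo[ : set R) (fun v => v `^ (- alpha) * psi (s * v)).
Proof.
move=> pcm s0; apply: measurable_funM.
  by apply: measurable_funTS; exact: measurable_powR.
apply: (measurable_comp (F := (`]0, +oo[%classic : set R))) => //.
- move=> _ [v /= + <-]; rewrite !in_itv /= !andbT => v1.
  by rewrite mulr_gt0// (lt_trans ltr01).
- exact: completely_monotonic_measurable.
Qed.

(** For psi t = t ^ alpha * phi t, the tail of phi beyond s is s ^ (1 - alpha)
    * tail_mean alpha psi s. *)
Definition tail_mean alpha psi s :=
  \int[mu]_(v in `]1, +oo[) (v `^ (- alpha) * psi (s * v)).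

(** A difference of step d at s becomes, under the dilation by v, a difference
    of step d * v at s * v. *)
Lemma tail_mean_bdiff alpha psi n d s :
  (forall s, 0 < s -> mu.-integrable `]1, +oo[
     (fun v => (v `^ (- alpha) * psi (s * v))%:E)) ->
  0 < d -> 0 < s ->
  mu.-integrable `]1, +oo[
    (fun v => (v `^ (- alpha) * iter n (bdiff (d * v)) psi (s * v))%:E) /\
  iter n (bdiff d) (tail_mean alpha psi) s =
  \int[mu]_(v in `]1, +oo[)
     (v `^ (- alpha) * iter n (bdiff (d * v)) psi (s * v)).
Proof.
move=> pint d0; elim: n s => [|n IH] s s0; first by split=> //; exact: pint.
have sd0 : 0 < s + d by rewrite addr_gt0.
have [i1 e1] := IH s s0; have [i2 e2] := IH (s + d) sd0.
have E v : v `^ (- alpha) * iter n.+1 (bdiff (d * v)) psi (s * v) =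
    v `^ (- alpha) * iter n (bdiff (d * v)) psi (s * v) -
    v `^ (- alpha) * iter n (bdiff (d * v)) psi ((s + d) * v).
  by rewrite /= /bdiff mulrDl mulrBr.
split.
  rewrite (_ : (fun v => _) = (fun v =>
    (v `^ (- alpha) * iter n (bdiff (d * v)) psi (s * v))%:E -
    (v `^ (- alpha) * iter n (bdiff (d * v)) psi ((s + d) * v))%:E)%E).
    exact: integrableB.
  by apply/funext => v; rewrite -EFinB -E.
rewrite /= {1}/bdiff e1 e2 -RintegralB//.
by apply: eq_Rintegral => v _; rewrite [RHS]E.
Qed.

Lemma tail_mean_difference_monotonic alpha psi : completely_monotonic psi ->
  (forall s, 0 < s -> mu.-integrable `]1, +oo[
     (fun v => (v `^ (- alpha) * psi (s * v))%:E)) ->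
  difference_monotonic (tail_mean alpha psi).
Proof.
move=> pcm pint n d s d0 s0.
have [_ ->] := @tail_mean_bdiff alpha psi n d s pint d0 s0.
apply: Rintegral_ge0 => v; rewrite /= in_itv /= andbT => v1.
have v0 : 0 < v by apply: lt_trans v1.
rewrite mulr_ge0 ?powR_ge0//.
by apply: completely_monotonic_difference => //; rewrite mulr_gt0.
Qed.

(** Along a sequence decreasing to s, psi (s v) dominates since psi is
    nonincreasing. *)
Lemma tail_mean_right_continuous alpha psi s : completely_monotonic psi ->
  (forall s, 0 < s -> mu.-integrable `]1, +oo[
     (fun v => (v `^ (- alpha) * psi (s * v))%:E)) ->
  0 < s -> tail_mean alpha psi x @[x --> s^'+] --> tail_mean alpha psi s.
Proof.
move=> pcm pint s0; apply/cvg_at_rightP => u [us ucvg].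
have u0 n : 0 < u n by apply: lt_trans (us n).
apply: fine_cvg; rewrite /tail_mean /Rintegral fineK; last first.
  by apply: integrable_fin_num => //; exact: pint.
apply: (@dominated_cvg _ _ _ mu _ _ (fun n v => (v `^ (- alpha) * psi (u n * v))%:E)
  _ (fun v => (v `^ (- alpha) * psi (s * v))%:E)) => //.
- by move=> n; apply/measurable_EFinP; exact: measurable_tail_mean.
- move=> v; rewrite /= in_itv /= andbT => v1.
  have v0 : 0 < v by apply: lt_trans v1.
  apply: cvg_EFin; first by apply: nearW.
  apply: cvgM; first exact: cvg_cst.
  have cpsi : {for s * v, continuous psi}.
    apply: differentiable_continuous; apply/derivable1_diffP.
    by apply: (pcm 0%N _ _).1; rewrite mulr_gt0.
  apply: (cvg_comp (fun n => u n * v) psi _ cpsi).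
  by apply: cvgM => //; exact: cvg_cst.
- exact: pint.
- move=> n v; rewrite /= in_itv /= andbT => v1.
  have v0 : 0 < v by apply: lt_trans v1.
  have p0 z : 0 < z -> 0 <= psi (z * v).
    by move=> z0; rewrite completely_monotonic_ge0// mulr_gt0.
  rewrite lee_fin ger0_norm ?mulr_ge0 ?powR_ge0 ?p0// ler_wpM2l ?powR_ge0//.
  apply: (difference_monotonic_nonincreasing (completely_monotonic_difference pcm)).
    by rewrite mulr_gt0.
  by rewrite ler_pM2r// ltW.
Qed.

End TailMean.

(** * The integral part of a Thorin-Bernstein function *)

Section Representation.
Variable R : realType.
Notation mu := (@lebesgue_measure R).
Implicit Types (alpha lambda s t x y : R).

(** Tonelli on the triangle 0 < s < t. Both functions are cut off outside the
    half-line, where nothing is known of them. *)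
Lemma ge0_integral_triangle (f k : R -> R) :
  measurable_fun (`]0, +oo[ : set R) f -> measurable_fun (`]0, +oo[ : set R) k ->
  (forall t, 0 < t -> 0 <= f t) -> (forall s, 0 < s -> 0 <= k s) ->
  (\int[mu]_(t in `]0%R, +oo[) ((f t)%:E * \int[mu]_(s in `]0%R, t[) (k s)%:E) =
   \int[mu]_(s in `]0%R, +oo[) ((k s)%:E * \int[mu]_(t in `]s, +oo[) (f t)%:E))%E.
Proof.
move=> mf mk f0 k0.
pose D : set R := `]0, +oo[%classic.
have inD t : (t \in D) = (0 < t) by rewrite /D mem_setE in_itv /= andbT.
have mD : measurable D by exact: measurable_itv.
pose T : set (R * R) := [set z | z.2 < z.1].
pose F (z : R * R) := ((f \_ D) z.1 * (k \_ D) z.2 * \1_T z)%:E.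
have mT : measurable T.
  have : measurable_fun setT (fun z : R * R => z.2 < z.1).
    exact: measurable_fun_ltr.
  move=> /(_ measurableT [set true]); rewrite setTI; exact.
have mF : measurable_fun setT F.
  apply/measurable_EFinP; apply: measurable_funM; last exact: measurable_indic.
  have mfD : measurable_fun setT (f \_ D) by apply/(measurable_restrictT _ mD).
  have mkD : measurable_fun setT (k \_ D) by apply/(measurable_restrictT _ mD).
  apply: measurable_funM.
    exact: (measurableT_comp mfD measurable_fst).
  exact: (measurableT_comp mkD measurable_snd).
have fD0 t : 0 <= (f \_ D) t by rewrite /patch; case: ifPn => //; rewrite inD;
  exact: f0.
have kD0 t : 0 <= (k \_ D) t by rewrite /patch; case: ifPn => //; rewrite inD;
  exact: k0.
have F0 z : (0 <= F z)%E by rewrite lee_fin !mulr_ge0.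
have FE t s : 0 < t -> 0 < s ->
    F (t, s) = ((f t)%:E * (k s)%:E * (\1_T (t, s))%:E)%E.
  by move=> t0 s0; rewrite /F /patch /= !inD t0 s0 !EFinM.
have iT t s : \1_T (t, s) = (s < t)%R%:R :> R.
  by rewrite indicE mem_setE.
transitivity (\int[mu]_(t in D) \int[mu]_(s in D) F (t, s))%E.
  apply: eq_integral => t; rewrite inD => t0.
  rewrite -ge0_integralZl_EFin ?f0//; last 2 first.
  - by move=> s /=; rewrite in_itv /= => /andP[s0 _]; rewrite lee_fin k0.
  - apply/measurable_EFinP; apply: measurable_funS mk => //.
    by move=> s /=; rewrite !in_itv /= => /andP[->].
  rewrite integral_mkcond [RHS]integral_mkcond; apply: eq_integral => s _.
  rewrite /patch inD mem_setE in_itv /=; case: ifPn => [/andP[s0 st]|].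
    by rewrite s0 FE// iT st mule1.
  have [s0 /=|//] := ltP 0 s; rewrite FE// iT => /negbTE ->.
  by rewrite mule0.
rewrite (ge0_integral_exchange mu mu mD mD mF F0).
apply: eq_integral => s; rewrite inD => s0.
rewrite -ge0_integralZl_EFin ?k0//; last 2 first.
- by move=> t /=; rewrite in_itv /= andbT => st; rewrite lee_fin f0// (lt_trans s0).
- apply/measurable_EFinP; apply: measurable_funS mf => //.
  by move=> t /=; rewrite !in_itv /= !andbT => /(lt_trans s0).
rewrite [LHS]integral_mkcond [RHS]integral_mkcond; apply: eq_integral => t _.
rewrite /patch inD mem_setE in_itv /= andbT; case: (ltP s t) => st.
  by rewrite (lt_trans s0 st) FE ?(lt_trans s0 st)// iT st mule1 muleC.
case: ifPn => // t0; rewrite FE// iT ltNge st mule0//.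
Qed.

Variables (lambda alpha : R) (phi : R -> R).
Hypotheses (lambda0 : 0 < lambda)
  (phi_cm : completely_monotonic_of_order alpha phi)
  (phi_int : forall x, 0 < x -> mu.-integrable `]0, +oo[
     (fun t => (incomplete_gamma lambda (x * t) * phi t)%:E)).

Let psi t := t `^ alpha * phi t.

Let psi_cm : completely_monotonic psi. Proof. exact: phi_cm. Qed.

Let phiE t : 0 < t -> phi t = t `^ (- alpha) * psi t.
Proof.
by move=> t0; rewrite /psi mulrA powRN mulVf ?mul1r// gt_eqF// powR_gt0.
Qed.

Let phi_ge0 t : 0 < t -> 0 <= phi t.
Proof.
by move=> t0; rewrite phiE// mulr_ge0 ?powR_ge0// completely_monotonic_ge0.
Qed.

Let measurable_phi : measurable_fun (`]0, +oo[ : set R) phi.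
Proof.
apply: (eq_measurable_fun (fun t => t `^ (- alpha) * psi t)).
  by move=> t; rewrite mem_setE in_itv /= andbT => t0; rewrite phiE.
apply: measurable_funM; last exact: completely_monotonic_measurable.
by apply: measurable_funTS; exact: measurable_powR.
Qed.

Let measurable_phi_tail s : 0 < s -> measurable_fun (`]s, +oo[ : set R) phi.
Proof.
move=> s0; apply: measurable_funS measurable_phi => // t /=.
by rewrite !in_itv /= !andbT; exact: lt_trans.
Qed.

(** On ]s, +oo[ the factor incomplete_gamma lambda t is at least
    incomplete_gamma lambda s > 0. *)
Let phi_tail_integrable s : 0 < s -> mu.-integrable `]s, +oo[ (EFin \o phi).
Proof.
move=> s0; have g0 := incomplete_gamma_gt0 lambda0 s0.
have ss : (`]s, +oo[%classic : set R) `<=` `]0, +oo[%classic.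
  by move=> t /=; rewrite !in_itv /= !andbT; exact: lt_trans.
have I : mu.-integrable `]s, +oo[ (fun t =>
    ((incomplete_gamma lambda s)^-1%:E * (incomplete_gamma lambda t * phi t)%:E)%E).
  apply: integrableZl => //; apply: (@integrableS _ _ _ mu _ _ _ _ _ ss) => //.
  rewrite (_ : (fun t => _) = fun t => (incomplete_gamma lambda (1 * t) * phi t)%:E).
    exact: phi_int.
  by apply/funext => t; rewrite mul1r.
apply: le_integrable I => //; first by apply/measurable_EFinP;
  exact: measurable_phi_tail.
move=> t; rewrite /= in_itv /= andbT => st.
have t0 : 0 < t by exact: lt_trans st.
rewrite lee_fin ger0_norm ?phi_ge0// mulrA.
apply: le_trans (ler_norm _); rewrite ler_peMl ?phi_ge0//.
by rewrite mulrC ler_pdivlMr// mul1r; exact/incomplete_gamma_le/ltW.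
Qed.

Let phi_tail s : 0 < s ->
  (\int[mu]_(t in `]s, +oo[) (phi t)%:E = (s * s `^ (- alpha))%:E *
   \int[mu]_(v in `]1%R, +oo[) (v `^ (- alpha) * psi (s * v))%:E)%E.
Proof.
move=> s0; rewrite (ge0_integral_dilation s0)//; last 2 first.
- by apply/measurable_EFinP; exact: measurable_phi_tail.
- by move=> t /=; rewrite in_itv /= andbT lee_fin => /(lt_trans s0)/phi_ge0.
have -> : [set x | `]s, +oo[%classic (s * x)] = `]1, +oo[%classic :> set R.
  apply/seteqP; split=> v /=; rewrite !in_itv /= !andbT.
    by rewrite -{1}[s]mulr1 ltr_pM2l.
  by rewrite -{1}[s]mulr1 ltr_pM2l.
rewrite EFinM -muleA; congr (_ * _)%E.
rewrite -ge0_integralZl_EFin ?powR_ge0//; last 2 first.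
- move=> v /=; rewrite in_itv /= andbT => v1; rewrite lee_fin mulr_ge0 ?powR_ge0//.
  by rewrite completely_monotonic_ge0// mulr_gt0// (lt_trans ltr01).
- by apply/measurable_EFinP; exact: measurable_tail_mean.
apply: eq_integral => v; rewrite mem_setE in_itv /= andbT => v1.
have v0 : 0 < v by exact: lt_trans v1.
by rewrite phiE ?mulr_gt0// powRM ?(ltW s0) ?(ltW v0)// -mulrA EFinM.
Qed.

Let psi_tail_integrable s : 0 < s -> mu.-integrable `]1, +oo[
  (fun v => (v `^ (- alpha) * psi (s * v))%:E).
Proof.
move=> s0; apply/integrableP; split.
  by apply/measurable_EFinP; exact: measurable_tail_mean.
have : (\int[mu]_(t in `]s, +oo[) (phi t)%:E)%E \is a fin_num.
  by apply: integrable_fin_num => //; exact: phi_tail_integrable.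
rewrite phi_tail//.
have c0 : 0 < s * s `^ (- alpha) by rewrite mulr_gt0// powR_gt0.
rewrite [X in (X < _)%E](_ : _ = \int[mu]_(v in `]1%R, +oo[)
    (v `^ (- alpha) * psi (s * v))%:E)%E; last first.
  apply: eq_integral => v; rewrite mem_setE in_itv /= andbT => v1.
  rewrite ger0_norm// mulr_ge0 ?powR_ge0// completely_monotonic_ge0//.
  by rewrite mulr_gt0// (lt_trans ltr01).
(* A positive multiple of this nonnegative integral is finite. *)
case: (integral _ _ _) => [r _||]; first exact: ltry.
- by rewrite mulry gtr0_sg ?mul1e.
- by rewrite mulrNy gtr0_sg ?mul1e.
Qed.

Let a := lambda + 1 - alpha.
Hypothesis alpha_lt : alpha < lambda + 1.

Let a0 : 0 < a. Proof. by rewrite subr_gt0. Qed.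

(** All integrands are nonnegative, so both exchanges of integrals are
    instances of Tonelli's theorem; the powers collect to
    s ^ (lambda - 1) * s ^ (1 - alpha) = s ^ (a - 1), which the inner Gamma
    integral turns into the kernel of order a. *)
Lemma thorin_integral_stieltjes :
  exists nu : {sigma_finite_measure set (measurableTypeR R) -> \bar R},
  forall x, 0 < x ->
    (\int[mu]_(t in `]0%R, +oo[) (incomplete_gamma lambda (x * t) * phi t)%:E =
     (x `^ lambda)%:E *
     \int[nu]_(y in `[0%R, +oo[) (((x + y) `^ a)^-1 * gamma_value a)%:E)%E.
Proof.
have [nu nuE] := bernstein_difference
  (tail_mean_difference_monotonic psi_cm psi_tail_integrable)
  (fun s (spos : 0 < s) =>
     tail_mean_right_continuous psi_cm psi_tail_integrable spos).
exists nu => x x0.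
have tailE s : 0 < s -> (\int[mu]_(t in `]s, +oo[) (phi t)%:E =
    (s * s `^ (- alpha))%:E * \int[nu]_(y in `[0%R, +oo[) (expR (- (s * y)))%:E)%E.
  move=> s0; rewrite phi_tail// nuE// /tail_mean /Rintegral fineK//.
  by apply: integrable_fin_num => //; exact: psi_tail_integrable.
pose k s := s `^ (lambda - 1) * expR (- (x * s)).
have k0 s : 0 <= k s by rewrite mulr_ge0 ?powR_ge0 ?expR_ge0.
transitivity ((x `^ lambda)%:E * \int[mu]_(t in `]0%R, +oo[)
    ((phi t)%:E * \int[mu]_(s in `]0%R, t[) (k s)%:E))%E.
  rewrite -ge0_integralZl_EFin ?powR_ge0//; last 2 first.
  - move=> t /=; rewrite in_itv /= andbT => t0.
    rewrite mule_ge0// ?lee_fin ?phi_ge0//.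
    by apply: integral_ge0 => s _; rewrite lee_fin.
  - apply: (eq_measurable_fun (fun t => ((x `^ lambda)^-1)%:E *
        (incomplete_gamma lambda (x * t) * phi t)%:E)%E).
      move=> t; rewrite mem_setE in_itv /= andbT => t0.
      rewrite EFinM incomplete_gammaE// !muleA -EFinM mulVf ?mul1e.
        by rewrite muleC.
      by rewrite gt_eqF// powR_gt0.
    by apply: measurable_funeM; have /integrableP[] := phi_int x0.
  apply: eq_integral => t; rewrite mem_setE in_itv /= andbT => t0.
  by rewrite muleCA -incomplete_gammaE// -EFinM mulrC.
congr (_ * _)%E; rewrite ge0_integral_triangle//; last first.
  exact: measurable_powR_expRN.
transitivity (\int[mu]_(s in `]0%R, +oo[) \int[nu]_(y in `[0%R, +oo[)
    (s `^ (a - 1) * expR (- ((x + y) * s)))%:E)%E.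
  apply: eq_integral => s; rewrite mem_setE in_itv /= andbT => s0.
  rewrite tailE// muleA -EFinM -ge0_integralZl_EFin//; last 2 first.
  - exact: measurable_expRN_lin.
  - by rewrite !mulr_ge0 ?powR_ge0// ltW.
  apply: eq_integral => y _; rewrite -EFinM; congr (_%:E).
  have -> : a - 1 = (lambda - 1) + (1 - alpha) by rewrite /a; ring.
  rewrite powRD; last by rewrite (gt_eqF s0) implybT.
  rewrite (@powRD _ _ 1) ?powRr1 ?(ltW s0)//; last by rewrite (gt_eqF s0) implybT.
  have -> : - ((x + y) * s) = - (x * s) + - (s * y) by ring.
  by rewrite expRD /k; ring.
rewrite (@ge0_integral_exchange _ _ _ _ _ mu nu _ _
  (fun z => (z.1 `^ (a - 1) * expR (- ((x + z.2) * z.1)))%:E))//; last 2 first.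
- apply/measurable_EFinP; apply: measurable_funM.
    exact: (measurableT_comp (measurable_powR _) measurable_fst).
  apply: measurableT_comp => //; apply: measurableT_comp => //.
  apply: measurable_funM; last exact: measurable_fst.
  by apply: measurable_funD => //; exact: measurable_snd.
- by move=> z; rewrite lee_fin mulr_ge0 ?powR_ge0 ?expR_ge0.
apply: eq_integral => y; rewrite mem_setE in_itv /= andbT => y0.
by rewrite laplace_powR// ltr_wpDr.
Qed.

(** Along a sequence bounded by C the integrand is dominated by its value for
    x = C, and it tends to 0 pointwise like x ^ lambda. *)
Lemma thorin_integral_cvg0 :
  \int[mu]_(t in `]0, +oo[) (incomplete_gamma lambda (x * t) * phi t)
    @[x --> 0^'+] --> (0 : R).
Proof.
apply/cvg_at_rightP => u [u0 ucvg]; apply: fine_cvg.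
have [M [Mr HM]] : bounded_fun u by apply: cvg_seq_bounded; apply/cvg_ex; eexists;
  exact: ucvg.
pose C := `|M| + 1.
have C0 : 0 < C by rewrite ltr_pwDr.
have uC n : u n <= C.
  apply: le_trans (ler_norm _) _; apply: (HM C) => //.
  by rewrite /C (le_lt_trans (ler_norm M))// ltrDl.
rewrite (_ : 0%:E = \int[mu]_(t in `]0%R, +oo[) 0)%E; last by rewrite integral0.
have mG x : 0 < x -> measurable_fun (`]0, +oo[ : set R)
    (fun t => (incomplete_gamma lambda (x * t) * phi t)%:E).
  by move=> /phi_int/integrableP[].
apply: (@dominated_cvg _ _ _ mu _ _
  (fun n t => (incomplete_gamma lambda (u n * t) * phi t)%:E) _
  (fun t => (incomplete_gamma lambda (C * t) * phi t)%:E)) => //.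
- by move=> n; exact: mG.
- move=> t; rewrite /= in_itv /= andbT => t0.
  apply: cvg_EFin; first exact: nearW.
  rewrite -(mul0r (phi t)); apply: cvgM; last exact: cvg_cst.
  apply: (@squeeze_cvgr _ _ _ _ (fun=> 0) (fun n =>
    expR 1 * incomplete_gamma lambda 1 * (u n * t) `^ lambda)).
  + apply: nearW => n; rewrite incomplete_gamma_ge0 /=.
    by rewrite incomplete_gamma_ub// mulr_gt0.
  + exact: cvg_cst.
  + rewrite -[X in _ --> X](mulr0 (expR 1 * incomplete_gamma lambda 1)).
    apply: cvgM; first exact: cvg_cst.
    have /cvg_at_rightP := @powR_cvg0 R lambda lambda0; apply.
    split=> [n|]; first by rewrite mulr_gt0.
    by rewrite -[X in _ --> X](mul0r t); apply: cvgM => //; exact: cvg_cst.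
- exact: phi_int.
- move=> n t; rewrite /= in_itv /= andbT => t0.
  rewrite lee_fin ger0_norm ?mulr_ge0 ?incomplete_gamma_ge0 ?phi_ge0//.
  by rewrite ler_wpM2r ?phi_ge0// incomplete_gamma_le// ler_pM2r.
Qed.

End Representation.

(** * Thorin-Bernstein functions and generalized Stieltjes functions *)

Theorem proposition5p2 (R : realType) (lambda alpha : R) (f : R -> R)
  (lambda_gt0 : 0 < lambda) (alpha_lt : alpha < lambda + 1)
  (f_T : thorin_bernstein lambda alpha f) :
  generalized_stieltjes (lambda + 1 - alpha)
    (fun x : R => (f x - value_at_0 f) / x `^ lambda).
Proof.
have [A [B [phi [A0 B0 cm phi_int fE]]]] := f_T.
have [nu nuE] := thorin_integral_stieltjes lambda_gt0 cm phi_int alpha_lt.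
set a := lambda + 1 - alpha in nuE *.
have f0 : value_at_0 f = B.
  apply: cvg_lim => //; rewrite -[X in _ --> X]add0r -[X in _ --> X]addr0.
  have near0 : \forall x \near 0^'+, A * x `^ lambda + B +
     \int[lebesgue_measure]_(t in `]0, +oo[)
               (incomplete_gamma lambda (x * t) * phi t) = f x.
    by near=> x; rewrite fE.
  apply: cvg_trans (near_eq_cvg near0) _.
  apply: cvgD; last exact: thorin_integral_cvg0 lambda_gt0 cm phi_int.
  apply: cvgD; last exact: cvg_cst.
  rewrite -[X in _ --> X](mulr0 A); apply: cvgM; first exact: cvg_cst.
  exact: powR_cvg0.
pose g0 : {nonneg R} := NngNum (gamma_value_ge0 a).
pose m : {measure set (measurableTypeR R) -> \bar R} := mscale g0 nu.
have w0 x y : 0 <= ((x + y) `^ a)^-1 :> R by rewrite invr_ge0 powR_ge0.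
have mw x : measurable_fun (`[0, +oo[ : set (measurableTypeR R))
    (fun y : R => (((x + y) `^ a)^-1)%:E).
  apply: measurable_funTS; apply/measurable_EFinP.
  under eq_fun do rewrite -powRN.
  by apply: (measurableT_comp (measurable_powR _)); exact: measurable_funD.
have E (x : R) : 0 < x -> ((x `^ lambda)%:E *
   \int[m]_(y in `[0%R, +oo[) (((x + y) `^ a)^-1)%:E)%E =
   (\int[lebesgue_measure]_(t in `]0, +oo[)
      (incomplete_gamma lambda (x * t) * phi t))%:E.
  move=> x0; rewrite /Rintegral fineK; last first.
    by apply: integrable_fin_num => //; exact: phi_int.
  rewrite nuE// ge0_integral_mscale//; last by move=> y _; rewrite lee_fin.
  under [in RHS]eq_integral do rewrite mulrC EFinM.
  rewrite ge0_integralZl_EFin//; first by move=> y _; rewrite lee_fin.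
  exact: gamma_value_ge0.
have Ifin (x : R) : 0 < x ->
    (\int[m]_(y in `[0%R, +oo[) (((x + y) `^ a)^-1)%:E)%E \is a fin_num.
  move=> x0; have xl0 : 0 < x `^ lambda by rewrite powR_gt0.
  (* By E, a positive multiple of the integral is a real number. *)
  have := E x x0; case: (integral _ _ _) => // [|].
  - by rewrite mulry gtr0_sg ?mul1e.
  - by rewrite mulrNy gtr0_sg ?mul1e.
exists m, A; split=> // x x0.
  apply/integrableP; split => //.
  under eq_integral do rewrite /= ger0_norm//.
  rewrite -ge0_fin_numE ?Ifin//.
  by apply: integral_ge0 => y _; rewrite lee_fin.
have xl0 : x `^ lambda != 0 by rewrite gt_eqF// powR_gt0.
rewrite f0 fE// (_ : \int[lebesgue_measure]_(t in `]0, +oo[) _ =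
  x `^ lambda * \int[m]_(y in `[0, +oo[) ((x + y) `^ a)^-1).
  by field.
apply: EFin_inj; rewrite -E// EFinM; congr (_ * _)%E.
by rewrite /Rintegral fineK// Ifin.
Unshelve. all: by end_near. Qed.
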